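(* For all $A,B,P>0$ we have $$S(P|B)-S(P|A)=\int_0^\infty\left[\int_0^1 P\big((1-t)A+tB+\lambda P\big)^{-1}(B-A)\big((1-t)A+tB+\lambda P\big)^{-1}P\,dt\right]d\lambda.$$
   Context: All operators are bounded linear operators on a complex Hilbert space $H$. $T>0$ means that $T$ is positive ($\langle Tx,x\rangle\ge 0$ for all $x\in H$) and invertible. For $A,B>0$ the relative operator entropy is $S(A|B):=A^{1/2}\ln\left(A^{-1/2}BA^{-1/2}\right)A^{1/2}$ (continuous functional calculus). Integrals of operator-valued functions are Bochner integrals. *)

(* Defs.v *)
From HB Require Import structures.
From mathcomp Require Import all_boot all_order all_algebra sesquilinear.
From mathcomp Require Import complex.
From mathcomp Require Import all_classical all_reals all_analysis.

Set Implicit Arguments.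
Unset Strict Implicit.
Unset Printing Implicit Defensive.

Import Order.TTheory GRing.Theory Num.Theory.
Import numFieldNormedType.Exports.

Local Open Scope classical_set_scope.
Local Open Scope complex_scope.
Local Open Scope ring_scope.

(* The norm of a [normedModType R[i]] takes its values in [R[i]], where the
   nonnegative elements are exactly the nonnegative reals; [rnorm] is the same
   norm read in [R]. *)
Definition rnorm (R : realType) (V : normedModType R[i]) (x : V) : R :=
  complex.Re `|x|.

Section RealNorm.
Variables (R : realType) (V : normedModType R[i]).
Implicit Types x y : V.

Lemma rnormE x : (rnorm x)%:C = `|x|.
Proof. exact/RRe_real/normr_real. Qed.

Lemma rnorm_ge0 x : 0 <= rnorm x.
Proof. by rewrite -lecR rnormE; exact: normr_ge0. Qed.

Lemma rnormD x y : rnorm (x + y) <= rnorm x + rnorm y.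
Proof. by rewrite -lecR rmorphD /= !rnormE ler_normD. Qed.

Lemma rnorm0 : rnorm (0 : V) = 0.
Proof. by rewrite /rnorm normr0. Qed.

Lemma rnorm0_eq0 x : rnorm x = 0 -> x = 0.
Proof. by move=> x0; apply/normr0_eq0; rewrite -rnormE x0. Qed.

Lemma rnormZ (l : R[i]) x : rnorm (l *: x) = complex.Re `|l| * rnorm x.
Proof.
apply: (@complexI R); rewrite rnormE normrZ rmorphM /= rnormE.
by rewrite (RRe_real (normr_real l)).
Qed.

End RealNorm.

Section BoundedOperators.
Variables (R : realType) (V : normedModType R[i]).

Definition bounded_linear : {pred V -> V} :=
  [pred f : V -> V |
    `[< linear f /\ exists M : R, forall x, rnorm (f x) <= M * rnorm x >]].

Record bop := BOp { bop_fun :> V -> V; _ : bop_fun \in bounded_linear }.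

HB.instance Definition _ := [isSub for bop_fun].
HB.instance Definition _ := [Choice of bop by <:].

Lemma bounded_linearP (f : V -> V) :
  reflect (linear f /\ exists M : R, forall x, rnorm (f x) <= M * rnorm x)
    (f \in bounded_linear).
Proof. exact: asboolP. Qed.

Lemma bounded_linear_submod_closed : submod_closed bounded_linear.
Proof.
split.
  apply/bounded_linearP; split.
    by move=> a x y; rewrite /= scaler0 addr0.
  by exists 0 => x; rewrite mul0r rnorm0.
move=> a f g /bounded_linearP[lf [M fM]] /bounded_linearP[lg [N gN]].
apply/bounded_linearP; split.
  move=> c x y /=; rewrite !fctE lf lg !scalerDr !scalerA mulrC -!addrA.
  by congr (_ + _); rewrite addrCA.
exists (complex.Re `|a| * M + N) => x.
rewrite !fctE (le_trans (rnormD _ _))// mulrDl lerD// rnormZ -mulrA.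
by rewrite ler_wpM2l// -lecR; have := rnorm_ge0 (a : R[i]^o); rewrite -lecR.
Qed.

HB.instance Definition _ := GRing.isSubmodClosed.Build R[i] (V -> V)
  bounded_linear bounded_linear_submod_closed.
HB.instance Definition _ := [SubChoice_isSubLmodule of bop by <:].

Implicit Types S T : bop.

Lemma bop_linear T : linear T.
Proof. by case: T => f /= /bounded_linearP[]. Qed.

HB.instance Definition _ T :=
  GRing.isLinear.Build R[i] V V *:%R (bop_fun T) (bop_linear T).

Lemma bop_bounded T : exists M : R, forall x, rnorm (T x) <= M * rnorm x.
Proof. by case: T => f /= /bounded_linearP[]. Qed.

Lemma bopP S T : S =1 T -> S = T.
Proof. by move=> ST; apply/val_inj/funext. Qed.

Lemma bop0E x : (0 : bop) x = 0. Proof. by []. Qed.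
Lemma bopDE S T x : (S + T) x = S x + T x. Proof. by []. Qed.
Lemma bopNE T x : (- T) x = - T x. Proof. by []. Qed.
Lemma bopZE a T x : (a *: T) x = a *: T x. Proof. by []. Qed.

Lemma bop_id_subproof : id \in bounded_linear.
Proof.
by apply/bounded_linearP; split=> //; exists 1 => x; rewrite mul1r.
Qed.

Lemma bop_comp_subproof S T : S \o T \in bounded_linear.
Proof.
apply/bounded_linearP; split=> [a x y /=|]; first by rewrite !linearP.
have [M SM] := bop_bounded S; have [N TN] := bop_bounded T.
exists (Num.max M 0 * N) => x /=.
rewrite (le_trans (SM _))// -mulrA.
rewrite (@le_trans _ _ (Num.max M 0 * rnorm (T x)))//.
  by rewrite ler_wpM2r ?rnorm_ge0// le_max lexx.
by rewrite ler_wpM2l// le_max lexx orbT.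
Qed.

Definition bop_id : bop := BOp bop_id_subproof.
Definition bop_comp S T : bop := BOp (bop_comp_subproof S T).

Lemma bop_compA : associative bop_comp.
Proof. by move=> S T U; exact: bopP. Qed.
Lemma bop_comp1l : left_id bop_id bop_comp.
Proof. by move=> T; exact: bopP. Qed.
Lemma bop_comp1r : right_id bop_id bop_comp.
Proof. by move=> T; exact: bopP. Qed.
Lemma bop_compDl : left_distributive bop_comp +%R.
Proof. by move=> S T U; exact: bopP. Qed.
Lemma bop_compDr : right_distributive bop_comp +%R.
Proof. by move=> S T U; apply: bopP => x; exact: linearD. Qed.

(* Only a possibly trivial ring, since [V] may be the zero space. *)
HB.instance Definition _ := GRing.Zmodule_isPzRing.Build bop
  bop_compA bop_comp1l bop_comp1r bop_compDl bop_compDr.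

Lemma bop1E x : (1 : bop) x = x. Proof. by []. Qed.
Lemma bopME S T x : (S * T) x = S (T x). Proof. by []. Qed.

Lemma bop_scalerAl a S T : a *: (S * T) = (a *: S) * T.
Proof. exact: bopP. Qed.
Lemma bop_scalerAr a S T : a *: (S * T) = S * (a *: T).
Proof. by apply: bopP => x; rewrite bopME !bopZE linearZ. Qed.

Definition opnorm T : R := sup [set rnorm (T x) | x in [set x | rnorm x <= 1]].

Let opnorm_has_sup T :
  has_sup [set rnorm (T x) | x in [set x | rnorm x <= 1]].
Proof.
split; first by exists (rnorm (T 0)), 0; rewrite //= rnorm0.
have [M TM] := bop_bounded T; exists (Num.max M 0) => _ [x /= x1 <-].
rewrite (le_trans (TM x))// (@le_trans _ _ (Num.max M 0 * rnorm x))//.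
  by rewrite ler_wpM2r ?rnorm_ge0// le_max lexx.
by rewrite ler_piMr// le_max lexx orbT.
Qed.

Lemma opnorm_ge0 T : 0 <= opnorm T.
Proof.
have [_ hs] := opnorm_has_sup T; apply: (le_trans (rnorm_ge0 (T 0))).
by apply: ub_le_sup => //; exists 0; rewrite //= rnorm0.
Qed.

Lemma opnorm_ub T x : rnorm (T x) <= opnorm T * rnorm x.
Proof.
have [->|x0] := eqVneq x 0; first by rewrite linear0 rnorm0 mulr0.
have nx : 0 < rnorm x.
  rewrite lt_neqAle rnorm_ge0 andbT eq_sym; apply: contra_neq x0.
  exact: rnorm0_eq0.
have Re_inv : complex.Re `|((rnorm x)^-1)%:C| = (rnorm x)^-1.
  by rewrite ger0_norm// lecR invr_ge0 rnorm_ge0.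
rewrite -ler_pdivrMr// mulrC.
have -> : (rnorm x)^-1 * rnorm (T x) = rnorm (T (((rnorm x)^-1)%:C *: x)).
  by rewrite linearZ/= rnormZ Re_inv.
have [_ hs] := opnorm_has_sup T; apply: ub_le_sup => //.
exists (((rnorm x)^-1)%:C *: x) => //=.
by rewrite rnormZ Re_inv mulVf// gt_eqF.
Qed.

Lemma opnorm_le T M : (forall x, rnorm x <= 1 -> rnorm (T x) <= M) ->
  opnorm T <= M.
Proof.
move=> TM; apply: ge_sup; first by case: (opnorm_has_sup T).
by move=> _ [x /= x1 <-]; exact: TM.
Qed.

Lemma opnormD S T : opnorm (S + T) <= opnorm S + opnorm T.
Proof.
apply: opnorm_le => x x1; rewrite bopDE (le_trans (rnormD _ _))//.
rewrite lerD// (le_trans (opnorm_ub _ _))//.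
  by rewrite ler_piMr// opnorm_ge0.
by rewrite ler_piMr// opnorm_ge0.
Qed.

Let Re_norm_ge0 (a : R[i]) : 0 <= complex.Re `|a|.
Proof. by have := rnorm_ge0 (a : R[i]^o). Qed.

Lemma opnormZ (a : R[i]) T : opnorm (a *: T) = complex.Re `|a| * opnorm T.
Proof.
have le b U : opnorm (b *: U) <= complex.Re `|b| * opnorm U.
  apply: opnorm_le => x x1; rewrite bopZE rnormZ ler_wpM2l//.
  by rewrite (le_trans (opnorm_ub _ _))// ler_piMr// opnorm_ge0.
apply/eqP; rewrite eq_le le andTb.
have [->|a0] := eqVneq a 0; first by rewrite normr0 mul0r opnorm_ge0.
have na : 0 < complex.Re `|a|.
  rewrite lt_neqAle Re_norm_ge0 andbT eq_sym; apply: contra_neq a0.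
  exact: (@rnorm0_eq0 R R[i]^o).
rewrite mulrC -ler_pdivlMr// mulrC.
have {1}-> : T = a^-1 *: (a *: T) by rewrite scalerA mulVf// scale1r.
rewrite (le_trans (le _ _))// ler_wpM2r ?opnorm_ge0//.
rewrite normfV -[`|a|](@rnormE R R[i]^o).
by rewrite -fmorphV.
Qed.

Lemma opnorm_eq0 T : opnorm T = 0 -> T = 0.
Proof.
move=> T0; apply: bopP => x; apply/rnorm0_eq0/eqP.
by rewrite eq_le rnorm_ge0 andbT (le_trans (opnorm_ub _ _))// T0 mul0r.
Qed.

Let ler_opnormD S T : (opnorm (S + T))%:C <= (opnorm S)%:C + (opnorm T)%:C.
Proof. by rewrite -rmorphD lecR opnormD. Qed.

Let opnorm_normrZ a T : (opnorm (a *: T))%:C = `|a| * (opnorm T)%:C.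
Proof. by rewrite opnormZ rmorphM/= -[in RHS](@rnormE R R[i]^o a). Qed.

Let opnormC_eq0 T : (opnorm T)%:C = 0 -> T = 0.
Proof. by move=> /(@complexI R) /opnorm_eq0. Qed.

HB.instance Definition _ := Lmodule_isNormed.Build R[i] bop
  ler_opnormD opnorm_normrZ opnormC_eq0.

Lemma bop_normE T : `|T| = (opnorm T)%:C. Proof. by []. Qed.

Definition bop_invertible T : Prop := exists S, S * T = 1 /\ T * S = 1.

(* [0] if [T] is not invertible. *)
Definition bop_inv T : bop := xget 0 [set S | S * T = 1 /\ T * S = 1].

Definition spectrum T : set R[i] :=
  [set l | ~ bop_invertible (T - l *: (1 : bop))].

End BoundedOperators.

Section FunctionalCalculus.
Variables (R : realType) (V : normedModType R[i]).
Implicit Types (T X : bop V) (f : R -> R).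

Definition poly_bop (p : {poly R}) T : bop V :=
  \sum_(i < size p) (p`_i)%:C *: T ^+ i.

(* Continuous functional calculus of a self-adjoint [T], as the continuous
   extension of the polynomial one: [f(T)] is the norm limit of [p_n(T)] for
   polynomials [p_n] converging to [f] uniformly on the spectrum.  As the
   spectrum of a self-adjoint operator is real, real points and real
   polynomials suffice for a real-valued [f]. *)
Definition is_cfc f T X : Prop := exists p : nat -> {poly R},
  {uniform [set x : R | spectrum T x%:C],
     (fun n x => (p n).[x]) @ \oo --> f} /\
  (fun n => poly_bop (p n) T) @ \oo --> X.

(* [0] if no such [X] exists. *)
Definition cfc f T : bop V := xget 0 [set X | is_cfc f T X].

Definition bop_powR T (a : R) : bop V := cfc (fun x => x `^ a) T.

Definition rel_op_entropy (A B : bop V) : bop V :=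
  let A2 := bop_powR A (2^-1) in
  let A2' := bop_powR A (- 2^-1) in
  A2 * cfc (@ln R) (A2' * B * A2') * A2.

End FunctionalCalculus.

(* A complex Hilbert space is a [completeNormedModType R[i]] whose norm comes
   from an inner product; [dot] is linear in its first argument. *)
Definition norm_from_dot (R : realType) (H : normedModType R[i])
    (dot : {dot H for Num.conj}) : Prop :=
  forall x : H, `|x| ^+ 2 = dot x x.

(* The order of [R[i]] makes [0 <= z] entail that [z] is real. *)
Definition pos_invertible (R : realType) (H : normedModType R[i])
    (dot : {dot H for Num.conj}) (T : bop H) : Prop :=
  (forall x, 0 <= dot (T x) x) /\ bop_invertible T.

Section Bochner.
Context (d : measure_display) (X : measurableType d) (R : realType)
  (V : normedModType R[i]).
Variables (mu : {measure set X -> \bar R}) (D : set X).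
Implicit Types (s f : X -> V).

Definition bochner_simple s : Prop :=
  finite_set (range s) /\
  forall v, v != 0 -> measurable (D `&` s @^-1` [set v]) /\
                      (mu (D `&` s @^-1` [set v]) < +oo)%E.

Definition bochner_sintegral s : V :=
  \sum_(v \in [set v : V | v != 0])
    (fine (mu (D `&` s @^-1` [set v])))%:C *: v.

(* The almost everywhere convergence is the strong measurability of [f]; it
   makes the real integrands below measurable up to a [mu]-null set. *)
Definition is_bochner_integral f (v : V) : Prop :=
  exists s : nat -> X -> V,
  [/\ forall n, bochner_simple (s n),
      {ae mu, forall x, D x -> (fun n => s n x) @ \oo --> f x},
      (fun n => \int[mu]_(x in D) (rnorm (f x - s n x))%:E)%E @ \oo --> 0%E &
      (fun n => bochner_sintegral (s n)) @ \oo --> v].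

Definition bochner_integrable f : Prop := exists v, is_bochner_integral f v.

(* [0] if [f] is not integrable. *)
Definition bochner_integral f : V := xget 0 [set v | is_bochner_integral f v].

End Bochner.

(* Main.v *)
Require Import Defs.
From HB Require Import structures.
From mathcomp Require Import all_boot all_order all_algebra sesquilinear.
From mathcomp Require Import complex.
From mathcomp Require Import all_classical all_reals all_analysis.
From mathcomp Require Import ring lra.
From mathcomp Require Import measurable_realfun.

(** Put S = P^(1/2), S' = P^(-1/2), X = S' B S' and Y = S' A S', so that
    S(P|B) - S(P|A) = S (log X - log Y) S.

    For fixed l >= 0 the operator Z_t = (1 - t) A + t B + l P is invertible,
    and by the resolvent identity t |-> - P Z_t^-1 P has derivative
    P Z_t^-1 (B - A) Z_t^-1 P.  The inner integral is therefore
    P ((A + l P)^-1 - (B + l P)^-1) P, and since P = S S this is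
    S ((Y + l)^-1 - (X + l)^-1) S.  As (T + l)^-1 is the derivative of
    l |-> log (T + l), a primitive of the inner integral in the variable l is
    S (log (Y + l) - log (X + l)) S.  It tends to 0 at infinity, because
    log (T + l) = ln l + O(1/l) whatever the positive operator T, so the outer
    integral is the opposite of its value at l = 0
    ([entropy_inner_integral], [entropy_outer_integral]).

    Two tools make this rigorous.

    The functional calculus of a symmetric operator T rests on the bound
    |p(T)| <= sup |p| over the spectrum ([opnorm_poly_le]).  It holds because
    p(T) - |p(T)| and p(T) + |p(T)| cannot both be invertible on a nonzero
    space ([symop_norm_in_spectrum]), whereas a real polynomial without zeros
    on the spectrum has an invertible value ([poly_bop_invertible]: factor it
    over C; T - z is invertible for nonreal z).  With polynomial approximation
    ([lipschitz_poly_approx], by Bernstein polynomials), f(T) exists for f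
    Lipschitz on an interval around the spectrum, is unique, multiplicative,
    and bounded by sup |f|.  Every statement about logarithms of operators
    thereby reduces to an inequality about ln on the positive half-line.

    The fundamental theorem of calculus for the Bochner integral
    ([bochner_integral_derivative]) uses left-endpoint step functions and a
    quadratic remainder |F(x + h) - F(x) - h G(x)| <= C h^2.  Uniqueness of
    the integral ([bochner_integral_bopE]) is tested on the real functionals
    T |-> Re <T x, y>, for which it is that of a scalar Lebesgue integral.

    Throughout, positivity is used through Re <T x, y>: a positive invertible
    operator is symmetric and satisfies c |x|^2 <= Re <T x, x> with c > 0
    ([pos_invertible_coercive]), and this in turn gives invertibility, with
    |T^-1| <= 1/c ([coercive_invertible], [opnorm_inv_le]). *)
Set Implicit Arguments.
Unset Strict Implicit.
Unset Printing Implicit Defensive.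

Import Order.TTheory GRing.Theory Num.Theory.
Import numFieldNormedType.Exports.

Local Open Scope classical_set_scope.
Local Open Scope complex_scope.
Local Open Scope ring_scope.

(** * Identities in additive groups and rings *)
Lemma subr_swap (T : zmodType) (x y z t : T) :
  x - y - (z - t) = x - z - (y - t).
Proof. by rewrite opprD addrACA -opprD. Qed.

Lemma subr_swap2 (T : zmodType) (x1 x2 y1 y2 p q : T) :
  x1 - y1 - (x2 - y2) - (p - q) = (x1 - x2 - p) - (y1 - y2 - q).
Proof. by rewrite (subr_swap x1) subr_swap. Qed.

Lemma mulrB_mid (T : pzRingType) (p q u v : T) :
  p * u * q - p * v * q = p * (u - v) * q.
Proof. by rewrite -mulrBl -mulrBr. Qed.

Lemma sandwich_sub (T : pzRingType) (u v e : T) :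
  u * e * u - v * e * v = u * e * (u - v) + (u - v) * e * v.
Proof. by rewrite mulrBr !mulrBl addrA subrK. Qed.

(** * Real-valued norms and convergence *)
Section RealNormTheory.
Variables (R : realType) (V : normedModType R[i]).
Implicit Types x y : V.

Lemma rnormN x : rnorm (- x) = rnorm x.
Proof. by rewrite /rnorm normrN. Qed.

Lemma rnormB x y : rnorm (x - y) = rnorm (y - x).
Proof. by rewrite /rnorm distrC. Qed.

Lemma rnorm_sub x y : rnorm (x - y) <= rnorm x + rnorm y.
Proof. by rewrite -(rnormN y) rnormD. Qed.

Lemma rnorm_triangle y x z : rnorm (x - z) <= rnorm (x - y) + rnorm (y - z).
Proof. by rewrite -[x - z](subrKA y) rnormD. Qed.

Lemma rnormZR (a : R) x : rnorm (a%:C *: x) = `|a| * rnorm x.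
Proof. by rewrite rnormZ normc_def /= expr0n /= addr0 sqrtr_sqr. Qed.

Lemma rnorm_sum (I : Type) (r : seq I) (F : I -> V) :
  rnorm (\sum_(i <- r) F i) <= \sum_(i <- r) rnorm (F i).
Proof.
elim: r => [|i r IH]; first by rewrite !big_nil rnorm0.
by rewrite !big_cons (le_trans (rnormD _ _))// lerD2l.
Qed.

Lemma cvg_rnormP (T : Type) (F : set_system T) (FF : Filter F)
    (u : T -> V) (l : V) :
  u @ F --> l <-> forall e : R, 0 < e -> \forall t \near F, rnorm (l - u t) < e.
Proof.
rewrite cvgrPdist_lt; split=> [h e e0|h e e0].
  have : 0 < e%:C :> R[i] by rewrite ltcR.
  by move=> /h; apply: filterS => t; rewrite -rnormE ltcR.
have eE : e = (complex.Re e)%:C by rewrite RRe_real// gtr0_real.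
move: e0; rewrite eE ltcR => /h; apply: filterS => t.
by rewrite -rnormE ltcR.
Qed.

Lemma cvg_rnorm0P (u : nat -> V) (l : V) :
  u @ \oo --> l <-> (fun n => rnorm (u n - l)) @ \oo --> (0 : R).
Proof.
rewrite cvg_rnormP cvgrPdist_lt; split=> h e /h; apply: filterS => n.
  by rewrite sub0r normrN ger0_norm ?rnorm_ge0// rnormB.
by rewrite sub0r normrN ger0_norm ?rnorm_ge0// rnormB.
Qed.

Lemma cvg_rnorm_le (u : nat -> V) (l : V) (e : nat -> R) :
  (forall n, rnorm (u n - l) <= e n) -> e @ \oo --> (0 : R) -> u @ \oo --> l.
Proof.
move=> ue e0; apply/cvg_rnorm0P; apply: squeeze_cvgr (@cvg_cst _ _ _ _ _) e0.
by apply: nearW => n; rewrite rnorm_ge0 ue.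
Qed.

Lemma rnorm_limit_le (u : nat -> V) (l z : V) (c : R) :
  u @ \oo --> l -> (\forall n \near \oo, rnorm (u n - z) <= c) ->
  rnorm (l - z) <= c.
Proof.
move=> /cvg_rnormP ul uz; apply/ler_addgt0Pr => e e0.
near \oo => n; rewrite (le_trans (rnorm_triangle (u n) _ _))// addrC lerD//.
  by near: n.
by apply: ltW; near: n; exact: ul.
Unshelve. all: by end_near. Qed.

Lemma rnorm_le_eq0 x (e : nat -> R) :
  (forall n, rnorm x <= e n) -> e @ \oo --> (0 : R) -> x = 0.
Proof.
move=> xe e0; apply: rnorm0_eq0; apply/eqP; rewrite eq_le rnorm_ge0 andbT.
rewrite -(cvg_lim _ e0)//; apply: limr_ge; first by apply/cvg_ex; exists 0.
exact: nearW.
Qed.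

End RealNormTheory.

Lemma cvg_inv_succ (R : realType) (K : R) : (fun n => K * n.+1%:R^-1) @ \oo --> (0 : R).
Proof. by rewrite -(mulr0 K); apply: cvgMr; exact: cvg_harmonic. Qed.

Lemma real_le_eq0 (R : realType) (a : R) (e : nat -> R) :
  (forall n, `|a| <= e n) -> e @ \oo --> (0 : R) -> a = 0.
Proof.
move=> ae e0; apply: (@complexI R); apply: (@rnorm_le_eq0 R R[i]^o a%:C e) => //.
by move=> n; rewrite /rnorm normc_def/= expr0n addr0 sqrtr_sqr.
Qed.

(** The rate e bounds all later terms of the sequence, so it survives in the
    limit: the limit comes with an explicit error. *)
Lemma rnorm_cauchy_cvg (R : realType) (V : completeNormedModType R[i])
    (u : nat -> V) (e : nat -> R) :
  (forall m n, (m <= n)%N -> rnorm (u m - u n) <= e m) ->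
  e @ \oo --> (0 : R) ->
  exists l : V, forall m, rnorm (u m - l) <= e m.
Proof.
move=> ue e0; suff /cvg_ex[l ul] : cvg (u @ \oo).
  exists l => m; rewrite rnormB; apply: (rnorm_limit_le ul).
  by exists m => // n /= mn; rewrite rnormB ue.
apply/cauchy_cvgP/cauchy_ballP => eps eps0.
have eE : eps = (complex.Re eps)%:C by rewrite RRe_real// gtr0_real.
have ep : 0 < complex.Re eps / 2.
  by move: eps0; rewrite eE ltcR => ?; rewrite divr_gt0.
have /cvgrPdist_lt/(_ _ ep) [N _ Ne] := e0.
have {}Ne : e N < complex.Re eps / 2.
  have := Ne N (leqnn _); rewrite sub0r normrN.
  exact/le_lt_trans/ler_norm.
exists (u @` [set n | (N <= n)%N], u @` [set n | (N <= n)%N]) => /=.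
  by split; exists N => // n /= Nn; exists n.
move=> [x y] /= [[m Nm <-] [n Nn <-]].
rewrite -ball_normE /ball_/= -rnormE eE ltcR.
rewrite (le_lt_trans (rnorm_triangle (u N) _ _))//.
rewrite (splitr (complex.Re eps)) rnormB ltrD//.
  by rewrite (le_lt_trans (ue _ _ _)).
by rewrite (le_lt_trans (ue _ _ _)).
Qed.

(** * Operator norm, inverses and Neumann series *)
Section OperatorNorm.
Variables (R : realType) (V : normedModType R[i]).
Implicit Types S T : bop V.

Lemma rnorm_bop T : rnorm T = opnorm T.
Proof. by []. Qed.

Lemma opnormN T : opnorm (- T) = opnorm T.
Proof. exact: (rnormN (T : bop V)). Qed.

Lemma opnorm_sub S T : opnorm (S - T) <= opnorm S + opnorm T.
Proof. exact: (rnorm_sub (S : bop V)). Qed.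

Lemma opnormBC S T : opnorm (S - T) = opnorm (T - S).
Proof. exact: (rnormB (S : bop V)). Qed.

Lemma opnorm_triangle U S T : opnorm (S - T) <= opnorm (S - U) + opnorm (U - T).
Proof. exact: (rnorm_triangle (U : bop V)). Qed.

Lemma opnormZR (a : R) T : opnorm (a%:C *: T) = `|a| * opnorm T.
Proof. exact: (rnormZR a (T : bop V)). Qed.

Lemma opnormM S T : opnorm (S * T) <= opnorm S * opnorm T.
Proof.
apply: opnorm_le => x x1; rewrite bopME (le_trans (opnorm_ub _ _))//.
rewrite ler_wpM2l ?opnorm_ge0// (le_trans (opnorm_ub _ _))//.
by rewrite ler_piMr ?opnorm_ge0.
Qed.

Lemma opnorm_bound T (c : R) : 0 <= c ->
  (forall x, rnorm (T x) <= c * rnorm x) -> opnorm T <= c.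
Proof.
move=> c0 Tc; apply: opnorm_le => x x1.
by rewrite (le_trans (Tc x))// ler_piMr.
Qed.

Lemma opnorm0 : opnorm (0 : bop V) = 0.
Proof. by rewrite -rnorm_bop rnorm0. Qed.

Lemma opnorm1_le : opnorm (1 : bop V) <= 1.
Proof. by apply: opnorm_bound => // x; rewrite mul1r. Qed.

Lemma opnormM3 S T U (a b c : R) : opnorm S <= a -> opnorm T <= b ->
  opnorm U <= c -> opnorm (S * T * U) <= a * b * c.
Proof.
move=> Sa Tb Uc; have := opnorm_ge0 S; have := opnorm_ge0 T.
have := opnorm_ge0 U => U0 T0 S0.
rewrite (le_trans (opnormM _ _))// ler_pM ?opnorm_ge0//.
by rewrite (le_trans (opnormM _ _))// ler_pM.
Qed.

Lemma opnormX T n : opnorm (T ^+ n) <= opnorm T ^+ n.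
Proof.
elim: n => [|n IH]; first by rewrite !expr0 opnorm1_le.
by rewrite !exprS (le_trans (opnormM _ _))// ler_wpM2l ?opnorm_ge0.
Qed.

Lemma bop_invK T : bop_invertible T -> bop_inv T * T = 1 /\ T * bop_inv T = 1.
Proof. by move=> ?; exact: (@xgetPex _ 0 [set U : bop V | U * T = 1 /\ T * U = 1]). Qed.

Lemma bop_invertibleM S T :
  bop_invertible S -> bop_invertible T -> bop_invertible (S * T).
Proof.
move=> [S' [S'S SS']] [T' [T'T TT']]; exists (T' * S'); split.
  by rewrite mulrA -(mulrA T') S'S mulr1.
by rewrite mulrA -(mulrA S) TT' mulr1.
Qed.

(** If U inverts S T, then U T is a left inverse and T U a right inverse of S,
    and a left and a right inverse coincide. *)
Lemma bop_invertible_factor S T : S * T = T * S ->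
  bop_invertible (S * T) -> bop_invertible S.
Proof.
move=> STC [U [UST STU]]; have L : U * T * S = 1 by rewrite -mulrA -STC.
exists (U * T); split=> //; have {}STU : S * (T * U) = 1 by rewrite mulrA.
suff -> : U * T = T * U by [].
by rewrite -[LHS]mulr1 -STU mulrA L mul1r.
Qed.

Lemma bop_invertibleZ (a : R[i]) T : a != 0 ->
  bop_invertible T -> bop_invertible (a *: T).
Proof.
move=> a0 [S [ST TS]]; exists (a^-1 *: S); split.
  by rewrite -bop_scalerAl -bop_scalerAr scalerA mulVf// scale1r.
by rewrite -bop_scalerAl -bop_scalerAr scalerA mulfV// scale1r.
Qed.

Lemma bop_invertible1 : bop_invertible (1 : bop V).
Proof. by exists 1; rewrite mulr1. Qed.

End OperatorNorm.

Section OperatorCompleteness.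
Variables (R : realType) (V : completeNormedModType R[i]).
Implicit Types S T : bop V.

(** The limit is built pointwise; the error being at most e m times |x|,
    linearity, boundedness and the rate of convergence in norm are inherited
    at once. *)
Lemma bop_cauchy_cvg (u : nat -> bop V) (e : nat -> R) :
  (forall m n, (m <= n)%N -> opnorm (u m - u n) <= e m) ->
  e @ \oo --> (0 : R) ->
  exists l : bop V, forall m, opnorm (u m - l) <= e m.
Proof.
move=> ue e0.
have e_ge0 m : 0 <= e m.
  by apply: (le_trans _ (ue m m (leqnn _))); rewrite opnorm_ge0.
have uxe x m n : (m <= n)%N -> rnorm (u m x - u n x) <= e m * rnorm x.
  move=> mn; rewrite -[_ - _]/((u m - u n) x) (le_trans (opnorm_ub _ _))//.
  by rewrite ler_wpM2r ?rnorm_ge0// ue.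
have ex0 (x : V) : (fun n => e n * rnorm x) @ \oo --> (0 : R).
  by rewrite -(mul0r (rnorm x)); apply: cvgMl.
have /choice[f fP] : forall x, exists y, forall m, rnorm (u m x - y) <= e m * rnorm x.
  by move=> x; exact: rnorm_cauchy_cvg (uxe x) (ex0 x).
have fb : f \in bounded_linear (V := V).
  apply/bounded_linearP; split.
    move=> a x y; apply/eqP; rewrite -subr_eq0; apply/eqP.
    apply: (@rnorm_le_eq0 _ _ _ (fun m => e m * rnorm (a *: x + y)
      + complex.Re `|a| * (e m * rnorm x) + e m * rnorm y)) => [m|].
      have -> : f (a *: x + y) - (a *: f x + f y) =
          (f (a *: x + y) - u m (a *: x + y)) + a *: (u m x - f x)
          + (u m y - f y).
        by rewrite (linearP (u m)) scalerBr -(addrA (_ - _)) [X in _ = _ + X]addrACA -opprD subrKA.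
      rewrite (le_trans (rnormD _ _))// lerD//.
      rewrite (le_trans (rnormD _ _))// lerD//; first by rewrite rnormB.
      rewrite rnormZ ler_wpM2l// -lecR.
      by have := rnorm_ge0 (a : R[i]^o); rewrite -lecR.
    rewrite -[X in _ --> X](addr0 0) -[X in _ --> X + _](addr0 0).
    rewrite -{2}(mulr0 (complex.Re `|a|)).
    by apply: cvgD; [apply: cvgD|] => //; apply: cvgMr.
  exists (e 0%N + opnorm (u 0%N)) => x.
  rewrite -[f x](subKr (u 0%N x)) (le_trans (rnorm_sub _ _))//.
  by rewrite addrC mulrDl lerD// opnorm_ub.
exists (BOp fb) => m; apply: opnorm_bound => // x.
exact: fP.
Qed.

(** The partial sums of the geometric series of K have error k^m / (1 - k),
    and (1 - K) times a partial sum is 1 - K^m. *)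
Lemma neumann (K : bop V) : opnorm K < 1 -> bop_invertible (1 - K).
Proof.
set k := opnorm K => k1.
have k0 : 0 <= k := opnorm_ge0 K.
pose u n := \sum_(i < n) K ^+ i.
pose e n := k ^+ n / (1 - k).
have kn : (fun n => k ^+ n) @ \oo --> (0 : R).
  by apply: cvg_expr; rewrite ger0_norm.
have e0 : e @ \oo --> (0 : R).
  by rewrite -(mul0r (1 - k)^-1); apply: cvgMl.
have k1' : 0 < 1 - k by rewrite subr_gt0.
have ue m n : (m <= n)%N -> opnorm (u m - u n) <= e m.
  move=> mn; rewrite -rnorm_bop rnormB rnorm_bop /e ler_pdivlMr//.
  suff : opnorm (u n - u m) <= (k ^+ m - k ^+ n) / (1 - k).
    rewrite ler_pdivlMr// => /le_trans; apply.
    by rewrite gerBl exprn_ge0.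
  rewrite -(subnKC mn); elim: (n - m)%N => [|j IH].
    by rewrite addn0 !subrr mul0r opnorm0.
  rewrite addnS /u big_ord_recr/= addrAC (le_trans (opnormD _ _))//.
  rewrite (@le_trans _ _ ((k ^+ m - k ^+ (m + j)) / (1 - k) + k ^+ (m + j)))//.
    by rewrite lerD// opnormX.
  rewrite exprS; have k1n : 1 - k != 0 by rewrite gt_eqF.
  by rewrite le_eqVlt; apply/orP; left; apply/eqP; field.
have uK n : (1 - K) * u n = 1 - K ^+ n /\ u n * (1 - K) = 1 - K ^+ n.
  elim: n => [|n [IH1 IH2]].
    by rewrite /u big_ord0 mulr0 mul0r expr0 subrr.
  have -> : u n.+1 = u n + K ^+ n by rewrite /u big_ord_recr.
  rewrite mulrDr IH1 (mulrDl (u n)) IH2 mulrBl mulrBr mul1r mulr1.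
  by rewrite -exprS -exprSr; split; rewrite addrA subrK.
have [l ul] := bop_cauchy_cvg ue e0.
have small (X : bop V) (c : R) : (forall m, opnorm X <= k ^+ m + c * e m) -> X = 0.
  move=> h; apply: (@rnorm_le_eq0 _ (bop V) X _ h).
  by rewrite -[X in _ --> X](addr0 0) -{2}(mulr0 c); apply: cvgD => //; apply: cvgMr.
exists l; split; apply/eqP; rewrite -subr_eq0; apply/eqP.
  apply: (small _ (opnorm (1 - K))) => m.
  have -> : l * (1 - K) - 1 = - (u m - l) * (1 - K) - K ^+ m.
    by rewrite mulNr mulrBl (uK m).2 !opprB addrA addrAC addrK.
  rewrite (le_trans (opnorm_sub _ _))// addrC lerD// ?opnormX//.
  by rewrite (le_trans (opnormM _ _))// mulrC ler_wpM2l ?opnorm_ge0// opnormN.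
apply: (small _ (opnorm (1 - K))) => m.
have -> : (1 - K) * l - 1 = (1 - K) * - (u m - l) - K ^+ m.
  by rewrite mulrN mulrBr (uK m).1 !opprB addrA addrAC addrK.
rewrite (le_trans (opnorm_sub _ _))// addrC lerD// ?opnormX//.
by rewrite (le_trans (opnormM _ _))// ler_wpM2l ?opnorm_ge0// opnormN.
Qed.

End OperatorCompleteness.

(** * Symmetric and coercive operators *)
Section RealInnerProduct.
Variables (R : realType) (H : completeNormedModType R[i]).
Variable dot : {dot H for Num.conj}.
Hypothesis Hdot : norm_from_dot dot.
Implicit Types (x y z : H) (S T : bop H).

(** The real part of the inner product determines it, so that symmetry and
    positivity of a complex linear operator can be read on it; all estimates
    then take place in the ordered field R. *)
Definition rdot x y : R := complex.Re (dot x y).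

Lemma ReD (a b : R[i]) : complex.Re (a + b) = complex.Re a + complex.Re b.
Proof. by case: a b => [? ?] [? ?]. Qed.

Lemma ReZ (a : R) (b : R[i]) : complex.Re (a%:C * b) = a * complex.Re b.
Proof. by case: b => ? ? /=; rewrite mul0r subr0. Qed.

Lemma Re_conj (a : R[i]) : complex.Re (Num.conj a) = complex.Re a.
Proof. by case: a. Qed.

Lemma rdotC x y : rdot x y = rdot y x.
Proof. by rewrite /rdot hermC expr0 mul1r Re_conj. Qed.

Lemma rdotDl x y z : rdot (x + y) z = rdot x z + rdot y z.
Proof. by rewrite /rdot linearDl ReD. Qed.

Lemma rdotDr x y z : rdot x (y + z) = rdot x y + rdot x z.
Proof. by rewrite rdotC rdotDl !(rdotC x). Qed.

Lemma rdotZl (a : R) x y : rdot (a%:C *: x) y = a * rdot x y.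
Proof. by rewrite /rdot linearZl_LR ReZ. Qed.

Lemma rdotZr (a : R) x y : rdot x (a%:C *: y) = a * rdot x y.
Proof. by rewrite rdotC rdotZl rdotC. Qed.

Lemma rdotNl x y : rdot (- x) y = - rdot x y.
Proof. by rewrite -scaleN1r -(rmorphN1 (real_complex R)) rdotZl mulN1r. Qed.

Lemma rdotNr x y : rdot x (- y) = - rdot x y.
Proof. by rewrite rdotC rdotNl rdotC. Qed.

Lemma rdotBl x y z : rdot (x - y) z = rdot x z - rdot y z.
Proof. by rewrite rdotDl rdotNl. Qed.

Lemma rdotBr x y z : rdot x (y - z) = rdot x y - rdot x z.
Proof. by rewrite rdotDr rdotNr. Qed.

Lemma rdotxx x : rdot x x = rnorm x ^+ 2.
Proof. by rewrite /rdot -Hdot -rnormE -rmorphXn. Qed.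

(** At the vector b(y,y) x - b(x,y) y the form takes the value
    b(y,y) (b(x,x) b(y,y) - b(x,y)^2).  When b(x,x) = b(y,y) = 0, the vectors
    x + y and x - y give b(x,y) = 0. *)
Lemma psd_cauchy_schwarz (b : H -> H -> R) :
  (forall x y, b x y = b y x) ->
  (forall x y z, b (x + y) z = b x z + b y z) ->
  (forall (a : R) x y, b (a%:C *: x) y = a * b x y) ->
  (forall x, 0 <= b x x) ->
  forall x y, b x y ^+ 2 <= b x x * b y y.
Proof.
move=> bC bD bZ b0.
have bDr x y z : b x (y + z) = b x y + b x z by rewrite bC bD !(bC x).
have bZr (a : R) x y : b x (a%:C *: y) = a * b x y by rewrite bC bZ bC.
have E (s t : R) x y : 0 <= s ^+ 2 * b x x + 2 * s * t * b x y + t ^+ 2 * b y y.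
  have := b0 (s%:C *: x + t%:C *: y).
  rewrite bD !bDr !bZ !bZr (bC y x); congr (_ <= _); ring.
have pos x y : 0 < b y y -> b x y ^+ 2 <= b x x * b y y.
  move=> y0; have := E (b y y) (- b x y) x y.
  have -> : b y y ^+ 2 * b x x + 2 * b y y * - b x y * b x y
      + (- b x y) ^+ 2 * b y y = b y y * (b x x * b y y - b x y ^+ 2) by ring.
  by rewrite pmulr_rge0// subr_ge0.
move=> x y; have := b0 y; rewrite le_eqVlt => /orP[/eqP y0|]; last exact: pos.
have := b0 x; rewrite le_eqVlt => /orP[/eqP x0|/(pos y x)]; last first.
  by rewrite bC mulrC.
have := E 1 1 x y; have := E 1 (-1) x y; rewrite -x0 -y0.
rewrite !mulr0 !add0r !addr0 => h1 h2.
by rewrite (_ : b x y = 0) ?expr0n//; lra.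
Qed.

Lemma rdot_le x y : `|rdot x y| <= rnorm x * rnorm y.
Proof.
rewrite -(@ler_pXn2r _ 2)// ?nnegrE ?mulr_ge0 ?rnorm_ge0// exprMn -!rdotxx.
rewrite real_normK ?num_real//.
apply: psd_cauchy_schwarz; [exact: rdotC|exact: rdotDl|exact: rdotZl|].
by move=> z; rewrite rdotxx sqr_ge0.
Qed.

Definition symop T := forall x y, rdot (T x) y = rdot x (T y).

Lemma symop1 : symop 1. Proof. by []. Qed.
Lemma symopD S T : symop S -> symop T -> symop (S + T).
Proof. by move=> sS sT x y; rewrite !bopDE rdotDl rdotDr sS sT. Qed.
Lemma symopZ (a : R) T : symop T -> symop (a%:C *: T).
Proof. by move=> sT x y; rewrite !bopZE rdotZl rdotZr sT. Qed.
Lemma symopN T : symop T -> symop (- T).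
Proof. by move=> sT x y; rewrite !bopNE rdotNl rdotNr sT. Qed.
Lemma symopB S T : symop S -> symop T -> symop (S - T).
Proof. by move=> sS sT; apply: symopD => //; exact: symopN. Qed.
Lemma symopM S T : S * T = T * S -> symop S -> symop T -> symop (S * T).
Proof. by move=> ST sS sT x y; rewrite {1}ST !bopME sT sS. Qed.
Lemma symopX T n : symop T -> symop (T ^+ n).
Proof.
move=> sT; elim: n => [|n IH]; first by rewrite expr0.
by rewrite exprS; apply: symopM => //; rewrite -exprS -exprSr.
Qed.
Lemma symop_conj S T : symop S -> symop T -> symop (S * T * S).
Proof. by move=> sS sT x y; rewrite !bopME sS sT sS. Qed.

Lemma symop_limit (u : nat -> bop H) T (e : nat -> R) :
  (forall n, symop (u n)) -> (forall n, opnorm (u n - T) <= e n) ->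
  e @ \oo --> (0 : R) -> symop T.
Proof.
move=> su ue e0 x y; apply/eqP; rewrite -subr_eq0; apply/eqP.
apply: (@real_le_eq0 _ _ (fun n => e n * (2 * (rnorm x * rnorm y)))) => [n|].
  have -> : rdot (T x) y - rdot x (T y) =
      rdot x ((u n - T) y) - rdot ((u n - T) x) y.
    by rewrite !bopDE !bopNE rdotBl rdotBr su; ring.
  have ub z : rnorm ((u n - T) z) <= e n * rnorm z.
    by rewrite (le_trans (opnorm_ub _ _))// ler_wpM2r ?rnorm_ge0.
  rewrite (le_trans (ler_normB _ _))// (le_trans (lerD (rdot_le _ _) (rdot_le _ _)))//.
  rewrite (le_trans (lerD (ler_wpM2l (rnorm_ge0 _) (ub _)) (ler_wpM2r (rnorm_ge0 _) (ub _))))//.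
  by rewrite le_eqVlt; apply/orP; left; apply/eqP; ring.
by rewrite -(mul0r (2 * (rnorm x * rnorm y))); exact: cvgMl.
Qed.

(** Polarisation turns a bound on the quadratic form of a symmetric operator
    into a bound on its norm: 4 <Tx, y> is the difference of the quadratic
    form at x + y and x - y, and y is taken along T x with the length of x. *)
Lemma opnorm_numrange T (c : R) : symop T -> 0 <= c ->
  (forall x, `|rdot (T x) x| <= c * rnorm x ^+ 2) -> opnorm T <= c.
Proof.
move=> sT c0 Tc; apply: opnorm_bound => // x.
have key y : 2 * rdot (T x) y <= c * (rnorm x ^+ 2 + rnorm y ^+ 2).
  have := Tc (x + y); rewrite ler_norml => /andP[_].
  have := Tc (x - y); rewrite ler_norml => /andP[+ _].
  rewrite -!rdotxx !linearD !linearN/= !(rdotDl, rdotDr, rdotNl, rdotNr).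
  rewrite (rdotC (T y) x) -(sT x y) (rdotC y x); nra.
have [->|Tx0] := eqVneq (rnorm (T x)) 0; first by rewrite mulr_ge0 ?rnorm_ge0.
have [x0|x0] := eqVneq (rnorm x) 0.
  by rewrite (rnorm0_eq0 x0) linear0 !rnorm0 mulr0.
have := key ((rnorm x / rnorm (T x))%:C *: T x).
rewrite rdotZr rnormZR rdotxx ger0_norm ?divr_ge0 ?rnorm_ge0// divfK//.
have -> : rnorm x / rnorm (T x) * rnorm (T x) ^+ 2 = rnorm x * rnorm (T x).
  by field.
have -> : c * (rnorm x ^+ 2 + rnorm x ^+ 2) = 2 * (rnorm x * (c * rnorm x)) by ring.
by rewrite ler_pM2l// ler_pM2l// lt_neqAle eq_sym x0 rnorm_ge0.
Qed.

(** A quadratic form with real values is hermitian: Im <T(u + v), u + v> = 0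
    gives Im <T u, v> = - Im <T v, u>, and u = i x turns the imaginary parts
    into real ones. *)
Lemma symop_pos T : (forall x, 0 <= dot (T x) x) -> symop T.
Proof.
move=> T0 x y.
have Im0 z : complex.Im (dot (T z) z) = 0 by rewrite ger0_Im.
have ImD (a b : R[i]) : complex.Im (a + b) = complex.Im a + complex.Im b.
  by case: a b => [? ?] [? ?].
have cross u v : complex.Im (dot (T u) v) + complex.Im (dot (T v) u) = 0.
  have := Im0 (u + v).
  by rewrite (linearD T) linearDl !linearDr !ImD !Im0 add0r addr0.
have := cross ('i%C *: x) y.
rewrite linearZ/= linearZl_LR linearZr_LR/= => h.
rewrite (rdotC x) /rdot; move: h.
case: (dot (T x) y) => a b; case: (dot (T y) x) => c d /=.
by rewrite !mul0r !mul1r ?mulN1r ?oppr0 ?add0r ?sub0r ?addr0; lra.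
Qed.

(** The assertion [coercive (- b) (- T)] is the upper bound
    Re <T x, x> <= b |x|^2. *)
Definition coercive (c : R) T := forall x, c * rnorm x ^+ 2 <= rdot (T x) x.

Lemma coercive_le c c' T : c <= c' -> coercive c' T -> coercive c T.
Proof. by move=> cc Tc x; rewrite (le_trans _ (Tc x))// ler_wpM2r ?sqr_ge0. Qed.

Lemma coercive_lb c T x : 0 < c -> coercive c T -> c * rnorm x <= rnorm (T x).
Proof.
move=> c0 Tc; have [->|x0] := eqVneq (rnorm x) 0; first by rewrite mulr0 rnorm_ge0.
have {}x0 : 0 < rnorm x by rewrite lt_neqAle eq_sym x0 rnorm_ge0.
rewrite -(ler_pM2r x0) -mulrA -expr2 (le_trans (Tc x))//.
by rewrite (le_trans (ler_norm _))// rdot_le.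
Qed.

(** With M = |T| + c, the symmetric operator 1 - T/M has its quadratic form
    between 0 and (1 - c/M) |x|^2, hence a norm smaller than 1, and the
    Neumann series inverts T/M. *)
Lemma coercive_invertible c T : 0 < c -> symop T -> coercive c T ->
  bop_invertible T.
Proof.
move=> c0 sT Tc.
pose M := opnorm T + c.
have M0 : 0 < M by rewrite ltr_wpDl ?opnorm_ge0.
have Mn : M != 0 by rewrite gt_eqF.
pose K := 1 - (M^-1)%:C *: T.
have -> : T = M%:C *: (1 - K).
  by rewrite /K subKr scalerA -rmorphM/= mulfV// scale1r.
apply: bop_invertibleZ; first by rewrite fmorph_eq0.
apply: neumann; apply: (@le_lt_trans _ _ (1 - c / M)); last first.
  by rewrite gtrBl divr_gt0.
have cM : c / M <= 1 by rewrite ler_pdivrMr// mul1r /M lerDr opnorm_ge0.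
apply: opnorm_numrange; first by apply: symopB; [exact: symop1|exact: symopZ].
  by rewrite subr_ge0.
move=> x; rewrite /K bopDE bopNE bopZE rdotBl rdotZl rdotxx.
have Tx : rdot (T x) x <= M * rnorm x ^+ 2.
  rewrite (le_trans (ler_norm _))// (le_trans (rdot_le _ _))//.
  rewrite expr2 mulrA ler_wpM2r ?rnorm_ge0// (le_trans (opnorm_ub _ _))//.
  by rewrite ler_wpM2r ?rnorm_ge0// /M lerDl ltW.
rewrite ger0_norm; last by rewrite subr_ge0 mulrC ler_pdivrMr// mulrC.
rewrite mulrBl mul1r lerD2l lerN2 -mulrA mulrCA ler_pM2l ?invr_gt0//.
Qed.

Lemma opnorm_inv_le c S T : 0 < c -> coercive c T -> T * S = 1 ->
  opnorm S <= c^-1.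
Proof.
move=> c0 Tc TS; apply: opnorm_bound; first by rewrite invr_ge0 ltW.
move=> x; rewrite mulrC ler_pdivlMr// mulrC.
by rewrite (le_trans (coercive_lb _ c0 Tc))// -bopME TS.
Qed.

(** Cauchy-Schwarz for the form <T x, y>, applied to x and T x, gives
    |T x|^2 <= |T| <T x, x>; and |x| <= |T^-1| |T x|. *)
Lemma pos_invertible_coercive T : pos_invertible dot T ->
  symop T /\ exists2 c, 0 < c & coercive c T.
Proof.
move=> [T0 [S [ST TS]]]; have sT := symop_pos T0; split=> //.
have T0' x : 0 <= rdot (T x) x by have := T0 x; rewrite lecE => /andP[].
pose K := opnorm S ^+ 2 * opnorm T + 1.
have K0 : 0 < K by rewrite ltr_wpDl// mulr_ge0 ?sqr_ge0 ?opnorm_ge0.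
exists K^-1; first by rewrite invr_gt0.
move=> x; rewrite mulrC ler_pdivrMr// mulrC.
have xS : rnorm x <= opnorm S * rnorm (T x).
  by rewrite -{1}[x]bop1E -ST bopME opnorm_ub.
have TxT : rnorm (T x) ^+ 2 <= opnorm T * rdot (T x) x.
  have := @psd_cauchy_schwarz (fun x y => rdot (T x) y).
  move=> /(_ _ _ _ T0' x (T x)) /=.
  have h1 u v : rdot (T u) v = rdot (T v) u by rewrite sT rdotC.
  have h2 u v w : rdot (T (u + v)) w = rdot (T u) w + rdot (T v) w.
    by rewrite linearD rdotDl.
  have h3 (a : R) u v : rdot (T (a%:C *: u)) v = a * rdot (T u) v.
    by rewrite linearZ/= rdotZl.
  move=> /(_ h1 h2 h3); rewrite rdotxx => h.
  have [->|n0] := eqVneq (rnorm (T x)) 0.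
    by rewrite expr0n mulr_ge0 ?opnorm_ge0.
  have n0' : 0 < rnorm (T x) ^+ 2 by rewrite exprn_gt0// lt_neqAle eq_sym n0 rnorm_ge0.
  rewrite -(ler_pM2r n0') -expr2 (le_trans h)// [X in _ <= X]mulrAC mulrC ler_wpM2r//.
  rewrite (le_trans (ler_norm _))// (le_trans (rdot_le _ _))//.
  by rewrite expr2 mulrA ler_wpM2r ?rnorm_ge0// opnorm_ub.
apply: (@le_trans _ _ (opnorm S ^+ 2 * rnorm (T x) ^+ 2)).
  by rewrite -exprMn ler_pXn2r// nnegrE ?mulr_ge0 ?rnorm_ge0 ?opnorm_ge0.
rewrite (@le_trans _ _ (opnorm S ^+ 2 * (opnorm T * rdot (T x) x)))//.
  by rewrite ler_wpM2l ?sqr_ge0.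
by rewrite /K mulrDl mul1r mulrA lerDl.
Qed.

End RealInnerProduct.

(** * Polynomials of an operator *)
Section PolynomialCalculus.
Variables (R : realType) (V : normedModType R[i]).
Implicit Types (T : bop V) (p q : {poly R[i]}).

(** Values at T of complex polynomials: a real polynomial splits into linear
    factors only over C. *)
Definition peval p T : bop V := \sum_(i < size p) p`_i *: T ^+ i.

Lemma peval_widen n p T : (size p <= n)%N ->
  peval p T = \sum_(i < n) p`_i *: T ^+ i.
Proof.
move=> pn; rewrite /peval (big_ord_widen n (fun i => p`_i *: T ^+ i))//.
rewrite big_mkcond/=; apply: eq_bigr => i _.
by case: ltnP => // /(nth_default 0) ->; rewrite scale0r.
Qed.

Lemma pevalD p q T : peval (p + q) T = peval p T + peval q T.
Proof.
pose n := maxn (size p) (size q).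
rewrite (@peval_widen n (p + q)) ?size_polyD// (@peval_widen n p) ?leq_maxl//.
rewrite (@peval_widen n q) ?leq_maxr// -big_split/=.
by apply: eq_bigr => i _; rewrite coefD scalerDl.
Qed.

Lemma pevalZ c p T : peval (c *: p) T = c *: peval p T.
Proof.
rewrite (@peval_widen (size p)) ?size_scale_leq// scaler_sumr.
by apply: eq_bigr => i _; rewrite coefZ scalerA.
Qed.

Lemma pevalC c T : peval c%:P T = c *: (1 : bop V).
Proof.
rewrite (@peval_widen 1) ?size_polyC ?leq_b1//.
by rewrite big_ord1 coefC/= expr0.
Qed.

Lemma pevalMX p T : peval (p * 'X) T = peval p T * T.
Proof.
rewrite (@peval_widen (size p).+1) ?size_mulX_leq//.
  rewrite big_ord_recl coefMX/= scale0r add0r mulr_suml.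
  by apply: eq_bigr => i _; rewrite coefMX/= exprSr bop_scalerAl.
by rewrite (leq_trans (size_polyMleq _ _))// size_polyX addn2.
Qed.

Lemma pevalX T : peval 'X T = T.
Proof. by rewrite -['X]mul1r pevalMX pevalC scale1r mul1r. Qed.

Lemma peval_comm p T : T * peval p T = peval p T * T.
Proof.
rewrite /peval mulr_sumr mulr_suml; apply: eq_bigr => i _.
by rewrite -bop_scalerAr -bop_scalerAl -exprS -exprSr.
Qed.

Lemma pevalM p q T : peval (p * q) T = peval p T * peval q T.
Proof.
elim/poly_ind: p => [|p c IH].
  by rewrite mul0r -(scale0r (1 : {poly R[i]})) !pevalZ !scale0r mul0r.
rewrite mulrDl -mulrA ['X * _]mulrC mulrA mul_polyC.
rewrite !pevalD !pevalMX pevalZ pevalC IH mulrDl -bop_scalerAl mul1r.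
by congr (_ + _); rewrite -!mulrA peval_comm.
Qed.

Lemma peval_prod_invertible (r : seq R[i]) T :
  (forall z, z \in r -> bop_invertible (T - z *: (1 : bop V))) ->
  bop_invertible (peval (\prod_(z <- r) ('X - z%:P)) T).
Proof.
elim: r => [|z r IH] h.
  by rewrite big_nil -polyC1 pevalC scale1r; exact: bop_invertible1.
rewrite big_cons pevalM; apply: bop_invertibleM; last first.
  by apply: IH => y yr; apply: h; rewrite inE yr orbT.
rewrite pevalD pevalX -polyCN pevalC scaleNr.
by apply: h; rewrite inE eqxx.
Qed.

Lemma bop_subM T (c : R[i]) :
  (T - c *: (1 : bop V)) * (T + c *: (1 : bop V)) = T * T - c ^+ 2 *: (1 : bop V).
Proof.
rewrite mulrBl !mulrDr -!bop_scalerAl -!bop_scalerAr !mul1r !mulr1.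
by rewrite opprD addrA addrK scalerA -expr2.
Qed.

Implicit Types f g : {poly R}.

Lemma poly_bopE f T : poly_bop f T = peval (map_poly (real_complex R) f) T.
Proof.
rewrite /peval size_map_poly; apply: eq_bigr => i _.
by rewrite coef_map.
Qed.

Lemma poly_bopD f g T : poly_bop (f + g) T = poly_bop f T + poly_bop g T.
Proof. by rewrite !poly_bopE rmorphD/= pevalD. Qed.

Lemma poly_bopM f g T : poly_bop (f * g) T = poly_bop f T * poly_bop g T.
Proof. by rewrite !poly_bopE rmorphM/= pevalM. Qed.

Lemma poly_bopZ (c : R) f T : poly_bop (c *: f) T = c%:C *: poly_bop f T.
Proof. by rewrite !poly_bopE map_polyZ pevalZ. Qed.

Lemma poly_bopC (c : R) T : poly_bop c%:P T = c%:C *: (1 : bop V).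
Proof. by rewrite !poly_bopE map_polyC pevalC. Qed.

Lemma poly_bopX T : poly_bop 'X T = T.
Proof. by rewrite !poly_bopE map_polyX pevalX. Qed.

Lemma poly_bopN f T : poly_bop (- f) T = - poly_bop f T.
Proof. by rewrite -scaleN1r poly_bopZ rmorphN1 scaleN1r. Qed.

Lemma poly_bopB f g T : poly_bop (f - g) T = poly_bop f T - poly_bop g T.
Proof. by rewrite poly_bopD poly_bopN. Qed.

End PolynomialCalculus.

(** * Norm of a polynomial of a symmetric operator *)
Section SpectralNorm.
Variables (R : realType) (H : completeNormedModType R[i]).
Variable dot : {dot H for Num.conj}.
Hypothesis Hdot : norm_from_dot dot.
Implicit Types (T S : bop H) (p q : {poly R}).

Lemma symop_poly p T : symop dot T -> symop dot (poly_bop p T).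
Proof.
move=> sT; apply: big_ind; first by move=> x y; rewrite /rdot linear0l linear0r.
  exact: symopD.
by move=> i _; apply: symopZ; exact: symopX.
Qed.

(** For z = a + ib with b nonzero, (T - z) (T - conj z) = (T - a)^2 + b^2 is
    coercive, hence invertible, and so are its two commuting factors. *)
Lemma symop_nonreal_invertible T (z : R[i]) : symop dot T ->
  complex.Im z != 0 -> bop_invertible (T - z *: (1 : bop H)).
Proof.
case: z => a b sT /= b0.
pose W := T - a%:C *: (1 : bop H).
have sW : symop dot W by apply: symopB => //; apply: symopZ; exact: symop1.
pose c : R[i] := 'i%C * b%:C.
have -> : T - (a +i* b) *: (1 : bop H) = W - c *: (1 : bop H).
  have -> : a +i* b = a%:C + c by rewrite [LHS]complexE.
  by rewrite scalerDl opprD addrA.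
have E : (W - c *: (1 : bop H)) * (W + c *: (1 : bop H)) =
    W * W + (b ^+ 2)%:C *: (1 : bop H).
  rewrite bop_subM -scaleNr; congr (_ + _ *: _).
  by rewrite /c exprMn sqr_i mulN1r opprK -rmorphXn.
have E' : (W + c *: (1 : bop H)) * (W - c *: (1 : bop H)) =
    W * W + (b ^+ 2)%:C *: (1 : bop H).
  rewrite -E bop_subM; have := bop_subM W (- c).
  by rewrite scaleNr opprK sqrrN => ->.
apply: (@bop_invertible_factor _ _ _ (W + c *: (1 : bop H))).
  by rewrite E E'.
rewrite E; apply: (@coercive_invertible _ _ _ Hdot (b ^+ 2)).
- by rewrite exprn_even_gt0.
- apply: symopD; first exact: symopM.
  by apply: symopZ; exact: symop1.
move=> x; rewrite bopDE bopME bopZE rdotDl rdotZl sW !(rdotxx Hdot) lerDr.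
by rewrite sqr_ge0.
Qed.

(** Factor p over C.  A factor T - z is invertible for nonreal z because T is
    symmetric, and for real z because the zero z of p is not in the
    spectrum. *)
Lemma poly_bop_invertible p T : symop dot T -> p != 0 ->
  (forall x : R, spectrum T x%:C -> p.[x] != 0) -> bop_invertible (poly_bop p T).
Proof.
move=> sT p0 ps; rewrite poly_bopE.
set pC := map_poly _ p.
have pC0 : pC != 0 by rewrite map_poly_eq0.
have [r rE] := closed_field_poly_normal pC.
rewrite rE pevalZ; apply: bop_invertibleZ; first by rewrite lead_coef_eq0.
apply: peval_prod_invertible => z zr.
have pz : root pC z by rewrite rE rootZ ?lead_coef_eq0// root_prod_XsubC.
have [zI|zI] := eqVneq (complex.Im z) 0; last exact: symop_nonreal_invertible.
have zE : z = (complex.Re z)%:C by case: z zI {zr pz} => a b /= ->.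
apply: contrapT => nz; have := ps (complex.Re z).
rewrite -zE => /(_ nz)/eqP; apply; apply: (@complexI R).
by move: pz; rewrite zE /root horner_map/= => /eqP.
Qed.

(** Some unit vectors x nearly attain N = |S|, and then (S^2 - N^2) x is nearly
    zero, which is impossible if S - N and S + N are both invertible, unless
    there are no unit vectors at all. *)
Lemma symop_norm_in_spectrum S : symop dot S ->
  bop_invertible (S - (opnorm S)%:C *: (1 : bop H)) ->
  bop_invertible (S + (opnorm S)%:C *: (1 : bop H)) ->
  (1 : bop H) = 0.
Proof.
move=> sS; set N := opnorm S => iB iD.
have [N0|N0] := eqVneq N 0.
  have S0 : S = 0 by apply: opnorm_eq0.
  move: iB; rewrite N0 S0 scale0r subr0 => -[W [_ W0]].
  by rewrite -W0 mul0r.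
have {N0} Np : 0 < N by rewrite lt_neqAle eq_sym N0 opnorm_ge0.
have [W [WQ _]] := bop_invertibleM iB iD.
exfalso.
have QE x : rnorm (((S - N%:C *: (1 : bop H)) * (S + N%:C *: (1 : bop H))) x) ^+ 2
    <= N ^+ 2 * (N ^+ 2 * rnorm x ^+ 2 - rnorm (S x) ^+ 2).
  have -> : ((S - N%:C *: (1 : bop H)) * (S + N%:C *: (1 : bop H))) x
      = S (S x) - (N ^+ 2)%:C *: x.
    rewrite bopME !bopDE !bopNE !bopZE !bop1E linearD linearZ/= scalerDr scalerA.
    by rewrite opprD addrA addrK -rmorphM.
  rewrite -!(rdotxx Hdot) rdotBl !rdotBr !rdotZl !rdotZr (rdotC _ x (S (S x))) (sS (S x) x).
  rewrite !(rdotxx Hdot).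
  have : rnorm (S (S x)) ^+ 2 <= N ^+ 2 * rnorm (S x) ^+ 2.
    by rewrite -exprMn ler_pXn2r ?nnegrE ?mulr_ge0 ?rnorm_ge0 ?opnorm_ge0// opnorm_ub.
  nra.
(* Applying the inverse W to the vector in QE gives
   |x|^2 <= K (N^2 |x|^2 - |S x|^2), that is |S x|^2 <= y |x|^2. *)
pose K := opnorm W ^+ 2 * N ^+ 2 + 1.
have K0 : 0 < K by rewrite ltr_wpDl// mulr_ge0 ?sqr_ge0.
pose y := N ^+ 2 - K^-1.
have Sy x : rnorm (S x) ^+ 2 <= y * rnorm x ^+ 2.
  have h1 : rnorm x ^+ 2 <= opnorm W ^+ 2 *
     rnorm (((S - N%:C *: (1 : bop H)) * (S + N%:C *: (1 : bop H))) x) ^+ 2.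
    rewrite -exprMn ler_pXn2r ?nnegrE ?mulr_ge0 ?rnorm_ge0 ?opnorm_ge0//.
    have {1}-> : x = W (((S - N%:C *: (1 : bop H)) * (S + N%:C *: (1 : bop H))) x).
      by rewrite -bopME WQ.
    exact: opnorm_ub.
  have h2 : 0 <= N ^+ 2 * rnorm x ^+ 2 - rnorm (S x) ^+ 2.
    rewrite subr_ge0 -exprMn ler_pXn2r ?nnegrE ?mulr_ge0 ?rnorm_ge0 ?opnorm_ge0//.
    exact: opnorm_ub.
  have h3 : rnorm x ^+ 2 <= K * (N ^+ 2 * rnorm x ^+ 2 - rnorm (S x) ^+ 2).
    rewrite (le_trans h1)// (le_trans (ler_wpM2l (sqr_ge0 _) (QE x)))//.
    by rewrite mulrA /K mulrDl lerDl mul1r.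
  have h4 : K^-1 * rnorm x ^+ 2 <= N ^+ 2 * rnorm x ^+ 2 - rnorm (S x) ^+ 2.
    by rewrite mulrC ler_pdivrMr// mulrC.
  by rewrite /y mulrBl; lra.
have : N <= Num.sqrt y.
  apply: opnorm_bound; first exact: sqrtr_ge0.
  move=> x; rewrite -(@ler_pXn2r _ 2)// ?nnegrE ?mulr_ge0 ?rnorm_ge0 ?sqrtr_ge0//.
  rewrite exprMn (le_trans (Sy x))// ler_wpM2r ?sqr_ge0//.
  have [y0|y0] := leP 0 y; first by rewrite sqr_sqrtr.
  by rewrite (le_trans (ltW y0))// sqr_ge0.
rewrite leNgt => /negP; apply.
have [y0|y0] := leP 0 y; last by rewrite ltr0_sqrtr.
rewrite -(@ltr_pXn2r _ 2)// ?nnegrE ?sqrtr_ge0// ?opnorm_ge0//.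
by rewrite sqr_sqrtr// /y gtrBl invr_gt0.
Qed.

(** If N = |p(T)| exceeded M, then p - N and p + N would have no zero on the
    spectrum, so p(T) - N and p(T) + N would both be invertible and the space
    would be zero.  When the spectrum has no real point, the same argument
    for T in place of p(T) shows that the space is zero. *)
Lemma opnorm_poly_le p T (M : R) : symop dot T -> 0 <= M ->
  (forall x : R, spectrum T x%:C -> `|p.[x]| <= M) ->
  opnorm (poly_bop p T) <= M.
Proof.
move=> sT M0 pM.
suff [//|->] : opnorm (poly_bop p T) <= M \/ poly_bop p T = 0.
  by rewrite opnorm0.
apply: contrapT => /not_orP[/negP]; rewrite -ltNge; set N := opnorm _ => MN pT0.
have triv : (1 : bop H) = 0 -> False.
  by move=> h; apply: pT0; rewrite -[LHS]mulr1 h mulr0.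
have [[x xs]|ns] := pselect (exists x : R, spectrum T x%:C); last first.
  have inv x : bop_invertible (T - x%:C *: (1 : bop H)).
    by apply: contrapT => h; apply: ns; exists x.
  apply/triv/(symop_norm_in_spectrum sT) => //.
  by have := inv (- opnorm T); rewrite rmorphN scaleNr opprK.
apply/triv/(symop_norm_in_spectrum (symop_poly p sT)).
  rewrite -(poly_bopC _ T) -poly_bopB; apply: poly_bop_invertible => //.
    apply/negP => /eqP/(congr1 (fun q => q.[x])); rewrite !hornerE => /eqP.
    rewrite subr_eq0 => /eqP px; have := pM x xs.
    by rewrite px ger0_norm ?opnorm_ge0// leNgt MN.
  move=> y ys; rewrite !hornerE subr_eq0; apply/eqP => py; have := pM y ys.
  by rewrite py ger0_norm ?opnorm_ge0// leNgt MN.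
rewrite -(poly_bopC _ T) -poly_bopD; apply: poly_bop_invertible => //.
  apply/negP => /eqP/(congr1 (fun q => q.[x])); rewrite !hornerE => /eqP.
  rewrite addr_eq0 => /eqP px; have := pM x xs.
  by rewrite px normrN ger0_norm ?opnorm_ge0// leNgt MN.
move=> y ys; rewrite !hornerE addr_eq0; apply/eqP => py; have := pM y ys.
by rewrite py normrN ger0_norm ?opnorm_ge0// leNgt MN.
Qed.

Lemma spectrum_itv T (a b x : R) : symop dot T ->
  coercive dot a T -> coercive dot (- b) (- T) -> spectrum T x%:C -> a <= x <= b.
Proof.
move=> sT Ta Tb xs; apply/andP; split; rewrite leNgt; apply/negP => h; apply: xs.
  apply: (@coercive_invertible _ _ _ Hdot (a - x)); first by rewrite subr_gt0.
    by apply: symopB => //; apply: symopZ; exact: symop1.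
  move=> y; rewrite bopDE bopNE bopZE rdotBl rdotZl (rdotxx Hdot) mulrBl.
  by rewrite lerD2r; exact: Ta.
have -> : T - x%:C *: (1 : bop H) = (-1)%:C *: (x%:C *: (1 : bop H) - T).
  by rewrite rmorphN1 scaleN1r opprB.
apply: bop_invertibleZ; first by rewrite fmorph_eq0 oppr_eq0 oner_eq0.
apply: (@coercive_invertible _ _ _ Hdot (x - b)); first by rewrite subr_gt0.
  by apply: symopB => //; apply: symopZ; exact: symop1.
move=> y; rewrite bopDE bopZE rdotDl rdotZl (rdotxx Hdot) mulrBl.
by rewrite lerD2l -mulNr; exact: Tb.
Qed.

End SpectralNorm.

(** * Polynomial approximation of Lipschitz functions *)
Section Bernstein.
Variable R : realType.
Implicit Types (g h : nat -> R) (u : R).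

(** De Casteljau's recursion for the Bernstein polynomial
    sum_k C(n,k) U^k (1 - U)^(n - k) g(k). *)
Fixpoint bernstein (U : {poly R}) n g : {poly R} :=
  if n is m.+1 then (1 - U) * bernstein U m g + U * bernstein U m (g \o succn)
  else (g 0)%:P.

(** The mean of g over a binomial law of parameters n and u, by conditioning
    on the first trial. *)
Fixpoint binomial_mean u n g : R :=
  if n is m.+1 then (1 - u) * binomial_mean u m g + u * binomial_mean u m (g \o succn)
  else g 0.

Lemma horner_bernstein (U : {poly R}) n g x :
  (bernstein U n g).[x] = binomial_mean U.[x] n g.
Proof.
elim: n g => [|n IH] g /=; first by rewrite hornerC.
by rewrite !(hornerD, hornerM, hornerN, hornerC) !IH.
Qed.

Lemma binomial_mean_le u n g h : 0 <= u <= 1 ->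
  (forall k, (k <= n)%N -> g k <= h k) ->
  binomial_mean u n g <= binomial_mean u n h.
Proof.
move=> /andP[u0 u1]; elim: n g h => [|n IH] g h gh /=; first exact: gh.
rewrite lerD// ler_wpM2l ?subr_ge0//; apply: IH => k kn.
  by apply: gh; rewrite ltnW.
exact: gh.
Qed.

Lemma binomial_mean_affine u n (a b : R) g :
  binomial_mean u n (fun k => a + b * g k) = a + b * binomial_mean u n g.
Proof. by elim: n g => [//|n IH] g /=; rewrite !IH; ring. Qed.

(** Variance plus squared bias.  A success in the first trial shifts c to
    c - 1, which is why c is arbitrary in the induction. *)
Lemma binomial_variance u n (c : R) :
  binomial_mean u n (fun k => (k%:R - c) ^+ 2) =
  n%:R * u * (1 - u) + (n%:R * u - c) ^+ 2.
Proof.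
elim: n c => [|n IH] c /=; first by ring.
have -> : (fun k => (k%:R - c) ^+ 2) \o succn = (fun k => (k%:R - (c - 1)) ^+ 2).
  by apply/funext => k /=; rewrite -natr1 opprB addrA addrAC.
by rewrite !IH -natr1; ring.
Qed.

(** Bernstein's argument with n = m^2 nodes.  If x is at proportion u of
    [a, b], the k-th node is at distance (b - a) |k - n u| / m^2 from x, and
    |v| <= m/2 + v^2/(2m) replaces |k - n u| by its square, whose binomial
    mean n u (1 - u) is at most m^2.  The error is then at most
    L (b - a) / m. *)
Lemma lipschitz_poly_approx (a b L e : R) (f : R -> R) : a < b -> 0 < e ->
  (forall x y, a <= x <= b -> a <= y <= b -> `|f x - f y| <= L * `|x - y|) ->
  exists p : {poly R}, forall x, a <= x <= b -> `|p.[x] - f x| <= e.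
Proof.
move=> ab e0 fL; have d0 : 0 < b - a by rewrite subr_gt0.
have dn : b - a != 0 by rewrite gt_eqF.
have L0 : 0 <= L.
  have := fL a b; rewrite lexx (ltW ab) lexx => /(_ isT isT) h.
  rewrite -(@pmulr_lge0 _ `|a - b|); first exact: le_trans h.
  by rewrite normr_gt0 subr_eq0 lt_eqF.
pose m := (Num.truncn (L * (b - a) / e)).+1.
have mE : L * (b - a) / e <= m%:R.
  by rewrite ltW// truncnS_gt.
have m0 : 0 < m%:R :> R by rewrite ltr0n.
have mn : m%:R != 0 :> R by rewrite gt_eqF.
pose n := (m * m)%N.
have nE : n%:R = m%:R * m%:R :> R by rewrite natrM.
pose node k : R := a + (b - a) * (k%:R / n%:R).
pose U : {poly R} := (b - a)^-1 *: ('X - a%:P).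
exists (bernstein U n (f \o node)) => x xab.
rewrite horner_bernstein.
have -> : U.[x] = (x - a) / (b - a).
  by rewrite /U hornerZ hornerD hornerX hornerN hornerC mulrC.
set u := (x - a) / (b - a).
have u01 : 0 <= u <= 1.
  by rewrite divr_ge0 ?(ltW d0)//= ?ler_pdivrMr// ?mul1r ?lerD2r; lra.
have xE : x = a + (b - a) * u by rewrite /u; field.
pose alpha := L * (b - a) / (2 * m%:R).
pose beta := L * (b - a) / (2 * m%:R ^+ 3).
pose w k : R := alpha + beta * (k%:R - n%:R * u) ^+ 2.
have a0 : 0 <= alpha by rewrite divr_ge0 ?mulr_ge0 ?(ltW d0).
have b0 : 0 <= beta by rewrite divr_ge0 ?mulr_ge0 ?exprn_ge0 ?(ltW d0).
have wP k : (k <= n)%N -> `|f (node k) - f x| <= w k.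
  move=> kn; have k01 : 0 <= (k%:R / n%:R : R) <= 1.
    by rewrite divr_ge0//= ler_pdivrMr ?mul1r ?ler_nat// nE mulr_gt0.
  have nab : a <= node k <= b by rewrite /node; move: k01 => /andP[? ?]; nra.
  rewrite (le_trans (fL _ _ nab xab))//.
  have -> : node k - x = (b - a) / (m%:R * m%:R) * (k%:R - n%:R * u).
    by rewrite {1}xE /node nE; field.
  rewrite normrM ger0_norm; last by rewrite divr_ge0 ?mulr_ge0 ?(ltW d0).
  set v := k%:R - _.
  have vB : `|v| <= m%:R / 2 + v ^+ 2 / (2 * m%:R).
    rewrite -subr_ge0.
    have -> : m%:R / 2 + v ^+ 2 / (2 * m%:R) - `|v| = (`|v| - m%:R) ^+ 2 / (2 * m%:R).
      by rewrite -(real_normK (num_real v)); field.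
    by rewrite divr_ge0 ?sqr_ge0 ?mulr_ge0.
  have c0 : 0 <= L * ((b - a) / (m%:R * m%:R)).
    by rewrite mulr_ge0 ?divr_ge0 ?mulr_ge0 ?(ltW d0).
  rewrite mulrA (le_trans (ler_wpM2l c0 vB))// /w -/v /alpha /beta.
  by rewrite le_eqVlt; apply/orP; left; apply/eqP; field.
have W : binomial_mean u n w <= e.
  rewrite /w binomial_mean_affine binomial_variance subrr expr0n addr0.
  have : L * (b - a) / m%:R <= e by rewrite ler_pdivrMr// [e * _]mulrC -ler_pdivrMr.
  apply: le_trans.
  have -> : L * (b - a) / m%:R = alpha + alpha by rewrite /alpha; field.
  rewrite lerD2l.
  have -> : beta * (n%:R * u * (1 - u)) = alpha * (u * (1 - u)).
    by rewrite /beta /alpha nE; field.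
  by rewrite ler_piMr//; move/andP: u01 => [? ?]; nra.
have cst : f x = binomial_mean u n (fun k => f x + 0 * 0).
  by rewrite (binomial_mean_affine u n (f x) 0 (fun=> 0)) mul0r addr0.
have lo : f x - e <= binomial_mean u n (f \o node).
  apply: (@le_trans _ _ (binomial_mean u n (fun k => f x + (-1) * w k))).
    by rewrite binomial_mean_affine mulN1r lerD2l lerN2.
  apply: binomial_mean_le => // k /wP; rewrite ler_norml => /andP[+ _] /=.
  by rewrite mulN1r; lra.
have hi : binomial_mean u n (f \o node) <= f x + e.
  apply: (@le_trans _ _ (binomial_mean u n (fun k => f x + 1 * w k))).
    apply: binomial_mean_le => // k /wP; rewrite ler_norml => /andP[_] /=.
    by rewrite mul1r; lra.
  by rewrite binomial_mean_affine mul1r lerD2l.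
by rewrite ler_norml; apply/andP; split; lra.
Qed.

End Bernstein.

(** * Continuous functional calculus *)
Section Calculus.
Variables (R : realType) (H : completeNormedModType R[i]).
Variable dot : {dot H for Num.conj}.
Hypothesis Hdot : norm_from_dot dot.
Implicit Types (T S X Y : bop H) (p q : {poly R}) (f g : R -> R).

Lemma is_cfcP f T X : is_cfc f T X <-> forall e : R, 0 < e ->
  exists p : {poly R}, (forall x : R, spectrum T x%:C -> `|p.[x] - f x| <= e) /\
    opnorm (poly_bop p T - X) <= e.
Proof.
split=> [[p [pf pX]] e e0|h].
  have /= uE : nbhs (f : {uniform` [set x : R | spectrum T x%:C] -> R^o})
     [set h | forall x, spectrum T x%:C -> ball (f x) e (h x)].
    apply/uniform_nbhs; exists [set xy | ball xy.1 e xy.2]; split => //.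
    exact: entourage_ball (PosNum e0).
  have [N _ Nf] := pf _ uE.
  have /cvg_rnormP/(_ _ e0)[M _ MX] := pX.
  exists (p (maxn N M)); split=> [x xs|].
    have := Nf _ (leq_maxl N M) x xs; rewrite /= -ball_normE/= distrC.
    exact: ltW.
  by rewrite opnormBC ltW//; exact: (MX _ (leq_maxr N M)).
have /choice[p pP] : forall n, exists p : {poly R},
    (forall x : R, spectrum T x%:C -> `|p.[x] - f x| <= n.+1%:R^-1) /\
    opnorm (poly_bop p T - X) <= n.+1%:R^-1.
  by move=> n; apply: h; rewrite invr_gt0 ltr0n.
have inv0 : (fun n => n.+1%:R^-1) @ \oo --> (0 : R) by exact: cvg_harmonic.
exists p; split; last first.
  by apply: cvg_rnorm_le inv0 => n; have [] := pP n.
move=> P /uniform_nbhs[E [entE EP]].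
have [e /= e0 eE] : exists2 e : R, 0 < e & forall x y : R, `|x - y| < e -> E (x, y).
  by move: entE; rewrite -entourage_ballE => -[e /= e0 eE];
     exists e => // x y xy; apply: eE => /=; rewrite -ball_normE.
have /cvgrPdist_lt/(_ _ e0)[N _ Ne] := inv0.
exists N => // n /= Nn; apply: EP => x xs; apply: eE.
rewrite distrC (le_lt_trans ((pP n).1 x xs))//.
by have := Ne n Nn; rewrite sub0r normrN; exact/le_lt_trans/ler_norm.
Qed.

(** The bound for polynomials passes to the limit, since the approximating
    polynomials are bounded by M + e/2 on the spectrum. *)
Lemma is_cfc_opnorm_le f T X (M : R) : symop dot T -> is_cfc f T X -> 0 <= M ->
  (forall x : R, spectrum T x%:C -> `|f x| <= M) -> opnorm X <= M.
Proof.
move=> sT /is_cfcP fX M0 fM; apply/ler_addgt0Pr => e e0.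
have e2 : 0 < e / 2 by rewrite divr_gt0.
have [p [pf pX]] := fX _ e2.
have := @opnorm_poly_le _ _ _ Hdot p T (M + e / 2) sT.
rewrite addr_ge0 ?(ltW e2)// => /(_ isT) h.
have {}h : opnorm (poly_bop p T) <= M + e / 2.
  apply: h => x xs; rewrite -[p.[x]](subrK (f x)).
  by rewrite (le_trans (ler_normD _ _))// addrC lerD ?fM ?pf.
rewrite -[X](subKr (poly_bop p T)) (le_trans (opnorm_sub _ _))//.
by rewrite (splitr e) addrA lerD.
Qed.

Lemma is_cfcD f g T X Y : is_cfc f T X -> is_cfc g T Y ->
  is_cfc (fun x => f x + g x) T (X + Y).
Proof.
move=> /is_cfcP fX /is_cfcP gY; apply/is_cfcP => e e0.
have e2 : 0 < e / 2 by rewrite divr_gt0.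
have [p [pf pX]] := fX _ e2; have [q [qg qY]] := gY _ e2.
exists (p + q); split=> [x xs|].
  rewrite hornerD opprD addrACA (splitr e) (le_trans (ler_normD _ _))//.
  by rewrite lerD ?pf ?qg.
by rewrite poly_bopD opprD addrACA (splitr e) (le_trans (opnormD _ _))// lerD.
Qed.

Lemma is_cfcZ (c : R) f T X : is_cfc f T X -> is_cfc (fun x => c * f x) T (c%:C *: X).
Proof.
move=> /is_cfcP fX; apply/is_cfcP => e e0.
pose d := e / (`|c| + 1).
have c1 : 0 < `|c| + 1 by rewrite ltr_wpDl.
have d0 : 0 < d by rewrite divr_gt0.
have cd : `|c| * d <= e.
  by rewrite /d mulrCA ler_piMr ?(ltW e0)// ler_pdivrMr// mul1r lerDl.
have [p [pf pX]] := fX _ d0.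
exists (c *: p); split=> [x xs|].
  by rewrite hornerZ -mulrBr normrM (le_trans _ cd)// ler_wpM2l// pf.
by rewrite poly_bopZ -scalerBr opnormZR (le_trans _ cd)// ler_wpM2l.
Qed.

Lemma is_cfcB f g T X Y : is_cfc f T X -> is_cfc g T Y ->
  is_cfc (fun x => f x - g x) T (X - Y).
Proof.
move=> fX /(is_cfcZ (-1)); rewrite rmorphN1 scaleN1r => gY.
have := is_cfcD fX gY; congr is_cfc.
by apply/funext => x; rewrite mulN1r.
Qed.

Lemma is_cfc_poly p T : is_cfc (horner p) T (poly_bop p T).
Proof.
apply/is_cfcP => e e0; exists p; split=> [x _|].
  by rewrite subrr normr0 ltW.
by rewrite subrr opnorm0 ltW.
Qed.

Lemma is_cfc_id T : is_cfc id T T.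
Proof.
have := is_cfc_poly 'X T; rewrite poly_bopX; congr is_cfc.
by apply/funext => x; rewrite hornerX.
Qed.

Lemma is_cfc_cst (c : R) T : is_cfc (fun=> c) T (c%:C *: (1 : bop H)).
Proof.
have := is_cfc_poly c%:P T; rewrite poly_bopC; congr is_cfc.
by apply/funext => x; rewrite hornerC.
Qed.

(** The norm bound with M = 0 for f - g, which vanishes on the spectrum. *)
Lemma is_cfc_unique f g T X Y : symop dot T -> is_cfc f T X -> is_cfc g T Y ->
  (forall x : R, spectrum T x%:C -> f x = g x) -> X = Y.
Proof.
move=> sT fX gY fg; apply/eqP; rewrite -subr_eq0; apply/eqP/opnorm_eq0.
apply/eqP; rewrite eq_le opnorm_ge0 andbT.
apply: (is_cfc_opnorm_le sT (is_cfcB fX gY)) => // x /fg ->.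
by rewrite subrr normr0.
Qed.

Lemma cfcE f T X : symop dot T -> is_cfc f T X -> cfc f T = X.
Proof.
move=> sT fX; have fY : is_cfc f T (cfc f T).
  by rewrite /cfc; exact: (@xgetPex _ 0 [set Y | is_cfc f T Y] (ex_intro _ X fX)).
exact: is_cfc_unique sT fY fX _.
Qed.

(** The bound M on the spectrum makes the product of uniform approximations a
    uniform approximation of the product. *)
Lemma is_cfcM f g T X Y (M : R) : is_cfc f T X -> is_cfc g T Y ->
  (forall x : R, spectrum T x%:C -> `|f x| <= M) ->
  (forall x : R, spectrum T x%:C -> `|g x| <= M) ->
  is_cfc (fun x => f x * g x) T (X * Y).
Proof.
move=> fX gY fM gM; apply/is_cfcP => e e0.
pose K := `|M| + opnorm X + opnorm Y + 1.
have := opnorm_ge0 X; have := opnorm_ge0 Y; have := normr_ge0 M => nM nY nX.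
have K0 : 0 < K by rewrite /K; lra.
pose d := Num.min 1 (e / (2 * K + 1)).
have d0 : 0 < d by rewrite lt_min ltr01 divr_gt0//; lra.
have d1 : d <= 1 by rewrite ge_min lexx.
have de : d * (2 * K) <= e.
  have : d <= e / (2 * K + 1) by rewrite ge_min lexx orbT.
  by rewrite ler_pdivlMr; [nra|lra].
move/is_cfcP: fX => /(_ _ d0)[p [pf pX]].
move/is_cfcP: gY => /(_ _ d0)[q [qg qY]].
exists (p * q); split=> [x xs|].
  have -> : (p * q).[x] - f x * g x = (p.[x] - f x) * q.[x] + f x * (q.[x] - g x).
    by rewrite hornerM; ring.
  have ? : `|f x| <= K by rewrite (le_trans (fM x xs))// (le_trans (ler_norm M))// /K; lra.
  have ? : `|q.[x]| <= K.
    rewrite -[q.[x]](subrK (g x)) (le_trans (ler_normD _ _))//.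
    have := qg x xs; have := gM x xs; have := ler_norm M; rewrite /K; lra.
  rewrite (le_trans (ler_normD _ _))// !normrM.
  have := pf x xs; have := qg x xs; have := normr_ge0 (f x).
  have := normr_ge0 q.[x]; have := normr_ge0 (p.[x] - f x).
  have := normr_ge0 (q.[x] - g x); nra.
have -> : poly_bop (p * q) T - X * Y =
    (poly_bop p T - X) * poly_bop q T + X * (poly_bop q T - Y).
  by rewrite poly_bopM mulrBl mulrBr addrA subrK.
have ? : opnorm X <= K by rewrite /K; lra.
have ? : opnorm (poly_bop q T) <= K.
  rewrite -[poly_bop q T](subrK Y) (le_trans (opnormD _ _))//.
  by rewrite /K; lra.
rewrite (le_trans (opnormD _ _))// (le_trans (lerD (opnormM _ _) (opnormM _ _)))//.
have := opnorm_ge0 (poly_bop q T); have := opnorm_ge0 (poly_bop p T - X).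
have := opnorm_ge0 (poly_bop q T - Y); nra.
Qed.

Lemma is_cfc_symop f T X : symop dot T -> is_cfc f T X -> symop dot X.
Proof.
move=> sT [p [_ pX]].
apply: (@symop_limit _ _ _ Hdot (fun n => poly_bop (p n) T) X
  (fun n => opnorm (poly_bop (p n) T - X))) => //.
  by move=> n; exact: symop_poly.
exact/(cvg_rnorm0P (fun n => poly_bop (p n) T : bop H) X).1.
Qed.

(** By the norm bound, polynomials close to f on [a, b] have values at T that
    form a Cauchy sequence. *)
Lemma is_cfc_exists (a b L : R) f T : symop dot T -> a < b ->
  (forall x : R, spectrum T x%:C -> a <= x <= b) ->
  (forall x y, a <= x <= b -> a <= y <= b -> `|f x - f y| <= L * `|x - y|) ->
  is_cfc f T (cfc f T).
Proof.
move=> sT ab sab fL.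
have /choice[p pP] : forall n : nat, exists p : {poly R}, forall x,
    a <= x <= b -> `|p.[x] - f x| <= n.+1%:R^-1.
  by move=> n; apply: (lipschitz_poly_approx ab _ fL); rewrite invr_gt0 ltr0n.
pose e n : R := 2 * n.+1%:R^-1.
have inv0 : (fun n => n.+1%:R^-1) @ \oo --> (0 : R) by exact: cvg_harmonic.
have e0 : e @ \oo --> (0 : R) by rewrite -(mulr0 2); exact: cvgMr.
have [X pX] : exists X, forall m, opnorm (poly_bop (p m) T - X) <= e m.
  apply: bop_cauchy_cvg e0 => m n mn; rewrite -poly_bopB.
  apply: (opnorm_poly_le Hdot) => //; first by rewrite mulr_ge0 ?invr_ge0.
  move=> x /sab xs; rewrite hornerD hornerN -(subrKA (f x)).
  rewrite (le_trans (ler_normD _ _))// /e mulr_natl mulr2n lerD// ?pP//.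
  by rewrite distrC (le_trans (pP n x xs))// lef_pV2 ?posrE ?ltr0n// ler_nat.
suff fX : is_cfc f T X by rewrite (cfcE sT fX).
apply/is_cfcP => eps eps0.
have /cvgrPdist_lt/(_ _ eps0)[N _ Ne] := e0.
have {}Ne : e N <= eps.
  have := Ne N (leqnn N); rewrite sub0r normrN => /ltW.
  exact/le_trans/ler_norm.
exists (p N); split=> [x /sab xs|]; last exact: le_trans (pX N) Ne.
rewrite (le_trans _ Ne)// (le_trans (pP N x xs))// /e mulr_natl mulr2n lerDl.
by rewrite invr_ge0.
Qed.

End Calculus.

(** * Uniqueness of the Bochner integral *)
Section BochnerUniqueness.
Context (d : measure_display) (X : measurableType d) (R : realType)
  (V : normedModType R[i]).
Variables (mu : {measure set X -> \bar R}) (D : set X).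
Hypothesis mD : measurable D.

(** The integral of a nonnegative function is a supremum over the simple
    functions below it, hence monotone without measurability; the integrands
    |f - s| come with none. *)
Lemma ge0_le_integral_nonmeasurable (f g : X -> \bar R) :
  (forall x, D x -> 0 <= f x)%E -> (forall x, D x -> f x <= g x)%E ->
  (\int[mu]_(x in D) f x <= \int[mu]_(x in D) g x)%E.
Proof.
move=> f0 fg; have g0 x : D x -> (0 <= g x)%E.
  by move=> Dx; rewrite (le_trans (f0 x Dx))// fg.
rewrite !ge0_integralE//; apply: le_ereal_sup => _ [h /= hf <-]; exists h => //=.
move=> x; rewrite (le_trans (hf x))//.
by rewrite /patch; case: ifPn => // /set_mem /fg.
Qed.

(** A list of the nonzero values turns the sum over all nonzero vectors into
    an ordinary finite sum. *)
Lemma bochner_simple_values (s : X -> V) : bochner_simple mu D s ->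
  exists r : seq V, [/\ uniq r, forall v, v \in r -> v != 0,
    forall x, s x != 0 -> s x \in r &
    bochner_sintegral mu D s =
      \sum_(v <- r) (fine (mu (D `&` s @^-1` [set v])))%:C *: v].
Proof.
move=> [/finite_seqP[r0 r0E] ms].
pose r := undup [seq v <- r0 | v != 0].
have rP v : v \in r = (v != 0) && (v \in r0) by rewrite mem_undup mem_filter.
have sr x : s x != 0 -> s x \in r.
  move=> sx; rewrite rP sx/=.
  by have : range s (s x) by []; rewrite r0E.
exists r; split => //; first exact: undup_uniq.
  by move=> v; rewrite rP => /andP[].
rewrite /bochner_sintegral (fsbigE r)//.
- rewrite big_seq_cond [RHS]big_seq; apply: eq_bigl => v.
  by rewrite rP; case: (eqVneq v 0) => //= v0; rewrite mem_set ?andbT.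
- exact: undup_uniq.
- by move=> v /=; rewrite rP => /andP[].
- move=> v /= v0 vr; rewrite (_ : D `&` _ = set0) ?measure0 ?scale0r//.
  by apply/seteqP; split => // x [_ /= sx]; move: vr; rewrite -sx sr// sx.
Qed.

Variables (phi : V -> R) (C : R).
Hypothesis phiD : forall x y, phi (x + y) = phi x + phi y.
Hypothesis phiZ : forall (a : R) x, phi (a%:C *: x) = a * phi x.
Hypothesis C0 : 0 < C.
Hypothesis phiC : forall x, `|phi x| <= C * rnorm x.

Let phi0 : phi 0 = 0.
Proof. by rewrite -(scale0r 0) -(rmorph0 (real_complex R)) phiZ mul0r. Qed.

Let phiB x y : phi (x - y) = phi x - phi y.
Proof. by rewrite phiD -scaleN1r -(rmorphN1 (real_complex R)) phiZ mulN1r. Qed.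

Let phi_sum (I : eqType) (r : seq I) (F : I -> V) :
  phi (\sum_(i <- r) F i) = \sum_(i <- r) phi (F i).
Proof. by elim: r => [|i r IH]; rewrite ?big_nil ?phi0// !big_cons phiD IH. Qed.

(** The scalar function phi o s is the combination, with coefficients phi v,
    of the indicators of the level sets of s. *)
Lemma functional_bochner_sintegral (s : X -> V) : bochner_simple mu D s ->
  mu.-integrable D (EFin \o (phi \o s)) /\
  (\int[mu]_(x in D) (phi (s x))%:E = (phi (bochner_sintegral mu D s))%:E)%E.
Proof.
move=> bs; have [r [ur r0 sr ->]] := bochner_simple_values bs.
pose A v := D `&` s @^-1` [set v].
have mA v : v \in r -> measurable (A v) by move=> /r0 /(bs.2 v)[].
have muA v : v \in r -> (mu (A v) < +oo)%E by move=> /r0 /(bs.2 v)[].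
pose g v x : \bar R := ((phi v)%:E * (\1_(if v \in r then A v else set0) x)%:E)%E.
have mA' v : measurable (if v \in r then A v else set0) by case: ifPn => // /mA.
have ig1 v : mu.-integrable D (fun x => (\1_(if v \in r then A v else set0) x)%:E).
  apply/integrableP; split; first exact/measurable_EFinP/measurable_indic.
  rewrite (eq_integral (fun x => (\1_(if v \in r then A v else set0) x)%:E)); last first.
    by move=> x _; rewrite gee0_abs// lee_fin.
  rewrite integral_indic//; case: ifPn => [vr|_]; last by rewrite set0I measure0.
  rewrite (le_lt_trans _ (muA v vr))// le_measure ?inE//.
    by apply: measurableI => //; exact: mA.
  exact: mA.
have ig v : mu.-integrable D (g v) by exact: integrableZl.
have sE x : D x -> (phi (s x))%:E = \sum_(v <- r) g v x.
  move=> Dx.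
  have E v : v \in r -> g v x = (if s x == v then phi v else 0)%:E.
    move=> vr; rewrite /g vr -EFinM indicE; congr EFin.
    case: (eqVneq (s x) v) => sv; first by rewrite mem_set ?mulr1.
    by rewrite memNset ?mulr0// => -[_ /= /eqP]; rewrite (negPf sv).
  rewrite big_seq (eq_bigr _ E) -big_seq sumEFin; congr EFin.
  have [s0|sn0] := eqVneq (s x) 0.
    rewrite s0 phi0 big_seq big1// => v /r0 v0.
    by rewrite eq_sym (negPf v0).
  rewrite (bigD1_seq (s x) (sr x sn0) ur)/= eqxx big1 ?addr0// => v vs.
  by rewrite eq_sym (negPf vs).
split.
  apply: (@eq_integrable _ _ _ mu D mD (fun x => \sum_(v <- r) g v x)%E).
    by move=> x /set_mem Dx; rewrite /= sE.
  exact: integrable_sum.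
rewrite (eq_integral (fun x => \sum_(v <- r) g v x)%E); last first.
  by move=> x /set_mem; exact: sE.
rewrite integral_sum// phi_sum -sumEFin big_seq [RHS]big_seq.
apply: eq_bigr => v vr; rewrite integralZl// integral_indic// vr phiZ mulrC EFinM.
rewrite fineK; first by congr (_ * mu _)%E; rewrite setIC setIA setIid.
by rewrite ge0_fin_numE ?muA.
Qed.

(** A bounded functional turns both approximating sequences into simple
    approximations of the scalar function phi o f, where the usual uniqueness
    of the limit of the integrals applies. *)
Lemma functional_bochner_unique (f : X -> V) (v v' : V) :
  measurable_fun D (phi \o f) ->
  is_bochner_integral mu D f v -> is_bochner_integral mu D f v' ->
  phi v = phi v'.
Proof.
move=> mf [s [bs _ es vs]] [s' [bs' _ es' vs']].
have close t : bochner_simple mu D t ->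
    measurable_fun D (fun x => `|phi (f x) - phi (t x)|) /\
    (\int[mu]_(x in D) (`|phi (f x) - phi (t x)|)%:E <=
     C%:E * \int[mu]_(x in D) (rnorm (f x - t x))%:E)%E.
  move=> bt; have [/measurable_int it _] := functional_bochner_sintegral bt.
  have mt : measurable_fun D (fun x => `|phi (f x) - phi (t x)|).
    apply: measurableT_comp; first exact: normr_measurable.
    apply: measurable_funB => //; exact/measurable_EFinP.
  split=> //.
  have -> : (\int[mu]_(x in D) (`|phi (f x) - phi (t x)|)%:E =
     C%:E * \int[mu]_(x in D) (C^-1 * `|phi (f x) - phi (t x)|)%:E)%E.
    rewrite -ge0_integralZl_EFin//.
    - by apply: eq_integral => x _; rewrite -EFinM mulrA mulfV ?mul1r ?gt_eqF.
    - by move=> x _; rewrite lee_fin mulr_ge0// invr_ge0 ltW.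
    - by apply/measurable_EFinP; apply: measurable_funM.
    - exact: ltW.
  rewrite lee_wpmul2l ?lee_fin ?(ltW C0)//.
  apply: ge0_le_integral_nonmeasurable => x _.
    by rewrite lee_fin mulr_ge0// invr_ge0 ltW.
  by rewrite lee_fin mulrC ler_pdivrMr// mulrC -phiB.
apply/eqP; rewrite -subr_eq0 -normr_eq0; apply/eqP/le_anti; rewrite normr_ge0 andbT.
apply/ler_addgt0Pr => e e0; rewrite add0r.
pose eta := e / (4 * C).
have eta0 : 0 < eta by rewrite divr_gt0// mulr_gt0.
have small (u : nat -> \bar R) : u @ \oo --> 0%E -> \forall n \near \oo, (u n < eta%:E)%E.
  have U0 : nbhs (0 : \bar R)%E [set y | (y < eta%:E)%E].
    apply: open_nbhs_nbhs; split; first exact: open_ereal_lt_ereal.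
    by rewrite /= lte_fin.
  by move=> u0; exact: u0 _ U0.
near \oo => n.
have e1 : (\int[mu]_(x in D) (rnorm (f x - s n x))%:E < eta%:E)%E.
  by near: n; exact: small es.
have e2 : (\int[mu]_(x in D) (rnorm (f x - s' n x))%:E < eta%:E)%E.
  by near: n; exact: small es'.
have v1 : rnorm (v - bochner_sintegral mu D (s n)) < eta.
  by near: n; exact: (cvg_rnormP _ _ _).1 vs _ eta0.
have v2 : rnorm (v' - bochner_sintegral mu D (s' n)) < eta.
  by near: n; exact: (cvg_rnormP _ _ _).1 vs' _ eta0.
have [i1 I1] := functional_bochner_sintegral (bs n).
have [i2 I2] := functional_bochner_sintegral (bs' n).
have [m1 J1] := close _ (bs n); have [m2 J2] := close _ (bs' n).
have K : `|phi (bochner_sintegral mu D (s n)) - phi (bochner_sintegral mu D (s' n))|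
    <= C * eta + C * eta.
  rewrite -lee_fin -abse_EFin EFinB -I1 -I2 -integralB_EFin//.
  have ms1 := measurable_int _ i1; have ms2 := measurable_int _ i2.
  apply: le_trans (le_abse_integral _ _ _) _ => //.
    by apply: emeasurable_funB.
  apply: (@le_trans _ _ (\int[mu]_(x in D) ((`|phi (f x) - phi (s n x)|)%:E +
      (`|phi (f x) - phi (s' n x)|)%:E))%E).
    apply: ge0_le_integral_nonmeasurable => x _; first exact: abse_ge0.
    rewrite -EFinB abse_EFin -EFinD lee_fin.
    rewrite -(subrKA (phi (f x))) (le_trans (ler_normD _ _))//.
    by rewrite (distrC (phi (s n x))).
  rewrite ge0_integralD//; [|exact/measurable_EFinP|exact/measurable_EFinP].
  rewrite EFinD !EFinM; apply: leeD.
    by rewrite (le_trans J1)// lee_wpmul2l ?lee_fin ?(ltW C0)// ltW.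
  by rewrite (le_trans J2)// lee_wpmul2l ?lee_fin ?(ltW C0)// ltW.
have w1 : `|phi v - phi (bochner_sintegral mu D (s n))| <= C * eta.
  by rewrite -phiB (le_trans (phiC _))// ler_wpM2l ?(ltW C0)// ltW.
have w2 : `|phi v' - phi (bochner_sintegral mu D (s' n))| <= C * eta.
  by rewrite -phiB (le_trans (phiC _))// ler_wpM2l ?(ltW C0)// ltW.
have eE : e = C * eta + (C * eta + C * eta) + C * eta.
  by rewrite /eta; field; rewrite gt_eqF.
rewrite eE -(subrKA (phi (bochner_sintegral mu D (s' n)))).
rewrite (le_trans (ler_normD _ _))//; apply: lerD; last by rewrite distrC.
rewrite -(subrKA (phi (bochner_sintegral mu D (s n)))).
by rewrite (le_trans (ler_normD _ _))// lerD.
Unshelve. all: by end_near. Qed.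

End BochnerUniqueness.

Lemma is_bochner_integral_ext (d : measure_display) (X : measurableType d)
    (R : realType) (V : normedModType R[i]) (mu : {measure set X -> \bar R})
    (D : set X) (f g : X -> V) (v : V) :
  (forall x, D x -> f x = g x) ->
  is_bochner_integral mu D f v -> is_bochner_integral mu D g v.
Proof.
move=> fg [s [bs aes es vs]]; exists s; split => //.
  by apply: filterS aes => x fx Dx; rewrite -fg//; exact: fx.
apply: cvg_trans es; apply: near_eq_cvg; near=> n.
by apply: eq_integral => x /set_mem Dx; rewrite fg.
Unshelve. all: by end_near. Qed.

(** * Fundamental theorem of calculus for the Bochner integral *)
Section StepFunctions.
Variables (R : realType) (V : normedModType R[i]).
Notation mu := (@lebesgue_measure R).
Implicit Types (G : R -> V) (h : R) (N k : nat).

Definition cell h k : set R := `[k%:R * h, k.+1%:R * h[%classic.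

Definition left_step G h N (x : R) : V :=
  \sum_(k < N) (\1_(cell h k) x)%:C *: G (k%:R * h).

Lemma cellP h k x : cell h k x <-> k%:R * h <= x < k.+1%:R * h.
Proof. by rewrite /cell /= in_itv. Qed.

Lemma cell_disjoint h j k x : 0 < h -> cell h j x -> cell h k x -> j = k.
Proof.
move=> h0 /cellP/andP[jx xj] /cellP/andP[kx xk].
have : j%:R * h < k.+1%:R * h by exact: le_lt_trans jx xk.
have : k%:R * h < j.+1%:R * h by exact: le_lt_trans kx xj.
rewrite !ltr_pM2r// !ltr_nat !ltnS => kj jk.
by apply/eqP; rewrite eqn_leq jk kj.
Qed.

Lemma cell_cover h N x : 0 <= x < N%:R * h -> exists2 k, (k < N)%N & cell h k x.
Proof.
elim: N => [|N IH]; first by rewrite mul0r => /andP[x0 x1]; lra.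
move=> /andP[x0 xN]; have [xN'|xN'] := ltP x (N%:R * h).
  by have [|k kN kx] := IH; [rewrite x0|exists k => //; exact: ltnW].
by exists N => //; apply/cellP; rewrite xN' xN.
Qed.

Lemma left_stepE G h N k x : 0 < h -> (k < N)%N -> cell h k x ->
  left_step G h N x = G (k%:R * h).
Proof.
move=> h0 kN kx; rewrite /left_step (bigD1 (Ordinal kN))//=.
rewrite big1 ?addr0; first by rewrite indicE mem_set// scale1r.
move=> j jk; rewrite indicE memNset ?scale0r// => jx.
by move: jk; rewrite -val_eqE/= (cell_disjoint h0 jx kx) eqxx.
Qed.

Lemma left_step_out G h N x : 0 < h -> N%:R * h <= x -> left_step G h N x = 0.
Proof.
move=> h0 Nx; rewrite /left_step big1// => j _.
rewrite indicE memNset ?scale0r// => /cellP/andP[_].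
rewrite ltNge => /negP; apply; rewrite (le_trans _ Nx)// ler_wpM2r ?(ltW h0)//.
by rewrite ler_nat.
Qed.

Lemma left_step_neq0 G h N x : left_step G h N x != 0 ->
  exists2 k, (k < N)%N & cell h k x.
Proof.
move=> sx; apply: contrapT => nk; move/eqP: sx; apply.
rewrite /left_step big1// => j _; rewrite indicE memNset ?scale0r// => jx.
by apply: nk; exists (nat_of_ord j).
Qed.

Lemma left_step_preimage G h N (v : V) : 0 < h -> v != 0 ->
  left_step G h N @^-1` [set v] =
  \bigcup_(k in [set k | (k < N)%N && (G (k%:R * h) == v)]) cell h k.
Proof.
move=> h0 v0; apply/seteqP; split=> [x /= sx|x [k /= /andP[kN /eqP Gk] kx]].
  have [|k kN kx] := @left_step_neq0 G h N x; first by rewrite sx.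
  by exists k => //=; rewrite kN -(left_stepE G h0 kN kx) sx eqxx.
by rewrite (left_stepE G h0 kN kx).
Qed.

Lemma measure_cell h k : 0 < h -> mu (cell h k) = h%:E.
Proof.
move=> h0; rewrite lebesgue_measure_itv/= lte_fin ltr_pM2r// ltr_nat ltnSn.
by rewrite -EFinB -mulrBl -natrB// subSnn mul1r.
Qed.

Lemma measure_left_step_preimage G h N (v : V) : 0 < h -> v != 0 ->
  mu (left_step G h N @^-1` [set v] : set R) =
  (\sum_(k < N) if G (k%:R * h) == v then h else 0)%:E.
Proof.
move=> h0 v0; rewrite left_step_preimage//.
have fin : finite_set [set k | (k < N)%N && (G (k%:R * h) == v)].
  apply: (@sub_finite_set _ _ `I_N); last exact: finite_II.
  by move=> k /= /andP[].
rewrite measure_fin_bigcup//.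
- rewrite (fsbigE [seq k <- iota 0 N | G (k%:R * h) == v]); last 3 first.
  + by rewrite filter_uniq// iota_uniq.
  + by move=> k /=; rewrite mem_filter mem_iota add0n andbC.
  + by move=> k /= /andP[kN Gk]; rewrite mem_filter mem_iota add0n kN Gk.
  rewrite big_filter_cond big_mkcond/= -(big_mkord xpredT
    (fun k => if G (k%:R * h) == v then h else 0)) /index_iota subn0 -sumEFin.
  rewrite big_seq [RHS]big_seq; apply: eq_bigr => k; rewrite mem_iota add0n => /= kN.
  case: ifPn => [/andP[-> _]|]; first by rewrite measure_cell.
  by case: (eqVneq (G (k%:R * h)) v) => //= Gk; rewrite notin_setE/= kN Gk eqxx.
- move=> i j _ _ [x [ix jx]]; exact: cell_disjoint ix jx.
- by move=> k _; exact: measurable_itv.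
Qed.

Variable (D : set R).

Lemma setI_left_step G h N (v : V) : 0 < h ->
  (forall x, 0 <= x < N%:R * h -> D x) -> v != 0 ->
  D `&` left_step G h N @^-1` [set v] = left_step G h N @^-1` [set v].
Proof.
move=> h0 DN v0; apply/setIidr => x /= sx; apply: DN.
have [|k kN /cellP/andP[kx xk]] := @left_step_neq0 G h N x; first by rewrite sx.
rewrite (le_trans _ kx) ?mulr_ge0 ?(ltW h0)//= (lt_le_trans xk)//.
by rewrite ler_wpM2r ?(ltW h0)// ler_nat.
Qed.

Lemma bochner_simple_left_step G h N : 0 < h ->
  (forall x, 0 <= x < N%:R * h -> D x) ->
  bochner_simple mu D (left_step G h N).
Proof.
move=> h0 DN; split.
  apply: (@sub_finite_set _ _ [set` (0 :: [seq G (k%:R * h) | k <- iota 0 N])]).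
    move=> _ [x _ <-]; rewrite /= inE.
    have [//|/left_step_neq0[k kN kx]] := eqVneq (left_step G h N x) 0.
    rewrite (left_stepE G h0 kN kx)/=; apply/mapP; exists k => //.
    by rewrite mem_iota add0n.
  exact: finite_seq.
move=> v v0; rewrite setI_left_step//=. rewrite measure_left_step_preimage// ltry.
split => //; rewrite left_step_preimage//.
by apply: bigcup_measurable => k _; exact: measurable_itv.
Qed.

(** Several cells may carry the same value, so the cells are grouped by value
    and the two sums exchanged. *)
Lemma bochner_sintegral_left_step G h N : 0 < h ->
  (forall x, 0 <= x < N%:R * h -> D x) ->
  bochner_sintegral mu D (left_step G h N) =
  \sum_(k < N) h%:C *: G (k%:R * h).
Proof.
move=> h0 DN.
pose r := undup [seq v <- [seq G (k%:R * h) | k <- iota 0 N] | v != 0].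
have rP v : v \in r = (v != 0) && (v \in [seq G (k%:R * h) | k <- iota 0 N]).
  by rewrite mem_undup mem_filter.
have ur : uniq r by exact: undup_uniq.
rewrite /bochner_sintegral (fsbigE r)//; last 2 first.
- by move=> v /=; rewrite rP => /andP[].
- move=> v /= v0; rewrite rP v0/= => vr.
  rewrite setI_left_step//=. rewrite measure_left_step_preimage//= big1 ?scale0r// => k _.
  case: eqVneq => // Gk; move: vr; rewrite -Gk map_f//.
  by rewrite mem_iota add0n/=.
transitivity (\sum_(v <- r) \sum_(k < N)
    (if G (k%:R * h) == v then h%:C *: G (k%:R * h) else 0)).
  rewrite big_seq_cond [RHS]big_seq; apply: eq_big => v.
    by rewrite rP; case: (eqVneq v 0) => //= v0; rewrite mem_set ?andbT.
  rewrite rP => /andP[/andP[v0 _] _].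
  rewrite setI_left_step//=. rewrite measure_left_step_preimage//= rmorph_sum scaler_suml.
  by apply: eq_bigr => k _; case: eqVneq => [->|_] //; rewrite scale0r.
rewrite exchange_big/=; apply: eq_bigr => k _.
have [G0|Gn0] := eqVneq (G (k%:R * h)) 0.
  by rewrite G0 scaler0 big1// => v _; case: ifP.
have Gr : G (k%:R * h) \in r.
  by rewrite rP Gn0 map_f// mem_iota add0n/=.
rewrite (bigD1_seq _ Gr ur)/= eqxx big1 ?addr0// => v vk.
by rewrite eq_sym (negPf vk).
Qed.

(** With step h = L / N, the left Riemann sum telescopes against F up to N
    errors of size C h^2, and the step function is within C h of G on [0, L[;
    what remains is the tail of a dominating function. *)
Lemma bochner_integral_derivative (G F : R -> V) (w : R -> R) (C : R)
    (L : nat -> R) (N : nat -> nat) (v : V) :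
  measurable D -> (forall x, D x -> 0 <= x) ->
  (forall n, 1 <= L n) -> (forall n x, 0 <= x <= L n -> D x) ->
  (forall n, (0 < N n)%N) ->
  (fun n => C * (L n ^+ 2 / (N n)%:R)) @ \oo --> (0 : R) ->
  {ae mu, forall x, D x -> \forall n \near \oo, x < L n} ->
  (forall x y, D x -> D y -> rnorm (G x - G y) <= C * `|x - y|) ->
  (forall x h, D x -> 0 <= h -> D (x + h) ->
     rnorm (F (x + h) - F x - h%:C *: G x) <= C * h ^+ 2) ->
  measurable_fun D w -> (forall x, D x -> rnorm (G x) <= w x) ->
  (fun n => \int[mu]_(x in D `&` `[L n, +oo[) (w x)%:E)%E @ \oo --> 0%E ->
  (fun n => F (L n) - F 0) @ \oo --> v ->
  is_bochner_integral mu D G v.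
Proof.
move=> mD D0 L1 DL N0 LN0 aeL lipG FG mw Gw w0 Fv.
have L0 n : 0 < L n by exact: lt_le_trans (L1 n).
pose h n := L n / (N n)%:R.
have Nr n : 0 < (N n)%:R :> R by rewrite ltr0n.
have h0 n : 0 < h n by rewrite divr_gt0.
have Nh n : (N n)%:R * h n = L n by rewrite /h mulrC divfK// gt_eqF.
have Nhh n : L n * h n = L n ^+ 2 / (N n)%:R by rewrite /h mulrA expr2.
have DN n x : 0 <= x < (N n)%:R * h n -> D x.
  by move=> /andP[x0 xN]; apply: (DL n); rewrite x0 -Nh ltW.
have C0 : 0 <= C.
  have := lipG 0 (L 0%N); rewrite sub0r normrN gtr0_norm//.
  have D00 : D 0 by apply: (DL 0%N); rewrite lexx ltW.
  have DL0 : D (L 0%N) by apply: (DL 0%N); rewrite lexx ltW.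
  move=> /(_ D00 DL0) GL; rewrite -(pmulr_lge0 _ (L0 0%N)).
  exact: le_trans (rnorm_ge0 _) GL.
have step_close n x : 0 <= x < L n ->
    rnorm (G x - left_step G (h n) (N n) x) <= C * h n.
  move=> xL; have [|k kN kx] := @cell_cover (h n) (N n) x; first by rewrite Nh.
  have [kx1 kx2] : k%:R * h n <= x /\ x < k.+1%:R * h n.
    by move/cellP : kx => /andP[].
  have Dk : D (k%:R * h n).
    by apply: (DN n); rewrite mulr_ge0 ?(ltW (h0 n))//= ltr_pM2r// ltr_nat.
  have Dx : D x by apply: (DN n); rewrite Nh.
  rewrite (left_stepE G (h0 n) kN kx) (le_trans (lipG _ _ Dx Dk))// ler_wpM2l//.
  by rewrite ger0_norm ?subr_ge0// lerBlDl -[X in _ + X]mul1r -mulrDl natr1 ltW.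
exists (fun n => left_step G (h n) (N n)); split.
- by move=> n; apply: bochner_simple_left_step => // x; exact: DN.
- have aeF : Filter (almost_everywhere mu) by exact: ae_filter_ringOfSetsType.
  apply: filterS aeL => x xL Dx; apply/cvg_rnormP => e e0.
  have [M _ Mx] := xL Dx; have x0 : 0 <= x := D0 x Dx.
  have /cvgrPdist_lt/(_ _ e0) LNe := LN0.
  near=> n.
  have xLn : x < L n by apply: Mx => /=; near: n; exact: nbhs_infty_ge.
  rewrite (le_lt_trans (step_close n x _)) ?x0//.
  have : `|0 - C * (L n ^+ 2 / (N n)%:R)| < e by near: n.
  rewrite sub0r normrN; apply: le_lt_trans; apply: le_trans (ler_norm _).
  by rewrite -Nhh ler_wpM2l// ler_peMl// ltW.
- pose tail n := (\int[mu]_(x in D `&` `[L n, +oo[) (w x)%:E)%E.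
  apply: (@squeeze_cvge _ _ _ _ (fun=> 0%E) _
      (fun n => (C * (L n ^+ 2 / (N n)%:R))%:E + tail n)%E).
  + apply: nearW => n; apply/andP; split.
      by apply: integral_ge0 => x _; rewrite lee_fin rnorm_ge0.
    apply: (@le_trans _ _ (\int[mu]_(x in D) ((C * h n)%:E *
        (\1_(`[0, L n[%classic : set R) x)%:E +
        ((EFin \o w) \_ `[L n, +oo[) x))%E).
      apply: ge0_le_integral_nonmeasurable => x Dx; first by rewrite lee_fin rnorm_ge0.
      have [xL|Lx] := ltP x (L n).
        rewrite indicE mem_set ?mule1; last by rewrite /= in_itv/= D0.
        rewrite patchN ?adde0; last by rewrite notin_setE/= in_itv/= andbT leNgt xL.
        by rewrite lee_fin step_close// D0.
      rewrite indicE memNset ?mule0 ?add0e; last first.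
        by rewrite /= in_itv/= [x < _]ltNge Lx andbF.
      rewrite patchT ?inE/= ?in_itv/= ?Lx//.
      by rewrite lee_fin left_step_out ?Nh// subr0 Gw.
    have mI : measurable (`[0, L n[%classic : set R) by exact: measurable_itv.
    have mJ : measurable (`[L n, +oo[%classic : set R) by exact: measurable_itv.
    have Ch0 : 0 <= C * h n by rewrite mulr_ge0// ltW.
    rewrite ge0_integralD//; last 4 first.
    * by move=> x _; rewrite -EFinM lee_fin mulr_ge0.
    * apply/measurable_EFinP; apply: measurable_funM => //.
    * move=> x Dx; rewrite /patch; case: ifP => // _.
      by rewrite lee_fin (le_trans (rnorm_ge0 (G x)))// Gw.
    * apply/(measurable_restrict _ mJ mD).
      by apply: (measurable_funS mD) => //; exact/measurable_EFinP.
    rewrite -integral_mkcondr -/(tail n) leeD2r//.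
    rewrite ge0_integralZl_EFin//; last by apply/measurable_EFinP/measurable_indic.
    have -> : C * (L n ^+ 2 / (N n)%:R) = C * h n * L n by rewrite -Nhh; ring.
    rewrite integral_indic// (EFinM (C * h n)).
    apply: lee_wpmul2l; first by rewrite lee_fin.
    apply: (@le_trans _ _ (lebesgue_measure (`[0, L n[%classic : set R))).
      by rewrite le_measure ?inE//; exact: measurableI.
    by rewrite lebesgue_measure_itv/= lte_fin L0 -EFinB subr0.
  + exact: cvg_cst.
  rewrite -[X in _ --> X]add0e; apply: cvgeD => //.
  by apply: cvg_EFin => //; apply: nearW.
apply: (@cvg_rnorm_le _ _ _ _ (fun n => C * (L n ^+ 2 / (N n)%:R)
    + rnorm (F (L n) - F 0 - v))).
  move=> n; rewrite bochner_sintegral_left_step//; last exact: DN.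
  rewrite (le_trans (rnorm_triangle (F (L n) - F 0) _ _))// lerD2r.
  have -> : F (L n) - F 0 =
      \sum_(k < N n) (F (k%:R * h n + h n) - F (k%:R * h n)).
    rewrite -{1}(Nh n) -[in F 0](mul0r (h n)).
    have /= <- := telescope_sumr (fun k => F (k%:R * h n)) (leq0n (N n)).
    rewrite big_mkord.
    by apply: eq_bigr => k _; rewrite -natr1 mulrDl mul1r.
  rewrite rnormB -sumrB (le_trans (rnorm_sum _ _))//.
  apply: (@le_trans _ _ (\sum_(k < N n) C * h n ^+ 2)).
    apply: ler_sum => k _; have kN := ltn_ord k.
    have k0 : 0 <= k%:R * h n by rewrite mulr_ge0 // ltW.
    apply: FG.
    - by apply: (DN n); rewrite k0 ltr_pM2r// ltr_nat.
    - exact: ltW.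
    apply: (DL n); rewrite addr_ge0 ?(ltW (h0 n))//=.
    by rewrite -(Nh n) -[X in _ + X]mul1r -mulrDl natr1 ler_pM2r// ler_nat.
  have -> : C * (L n ^+ 2 / (N n)%:R) = (N n)%:R * (C * h n ^+ 2).
    by rewrite -Nhh -(Nh n); ring.
  by rewrite sumr_const card_ord mulr_natl.
rewrite -[X in _ --> X](addr0 0); apply: cvgD => //.
exact/cvg_rnorm0P.
Unshelve. all: by end_near. Qed.

End StepFunctions.

(** * Estimates for the logarithm, square root and inverse *)
Section ScalarEstimates.
Variable R : realType.
Implicit Types (x y c h : R).

(** Both bounds are ln (1 + z) <= z, for z = (y - x)/x and z = - (y - x)/y. *)
Lemma ln_secant x y : 0 < x -> x <= y ->
  (y - x) / y <= ln y - ln x <= (y - x) / x.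
Proof.
move=> x0 xy; have y0 : 0 < y := lt_le_trans x0 xy.
have xn : x != 0 by rewrite gt_eqF.
have yn : y != 0 by rewrite gt_eqF.
apply/andP; split.
  rewrite -lerN2 opprB -ln_div ?posrE//.
  have -> : x / y = 1 + - ((y - x) / y) by field.
  apply: le_ln1Dx; rewrite ltrN2 ltr_pdivrMr// mul1r; lra.
rewrite -ln_div ?posrE//.
have -> : y / x = 1 + (y - x) / x by field.
apply: le_ln1Dx; rewrite (lt_le_trans (_ : -1 < 0))//.
by rewrite divr_ge0 ?subr_ge0// ltW.
Qed.

Lemma ln_lipschitz c x y : 0 < c -> c <= x -> c <= y ->
  `|ln x - ln y| <= c^-1 * `|x - y|.
Proof.
move=> c0; wlog xy : x y / x <= y => [W cx cy|cx cy].
  have [xy|/ltW yx] := leP x y; first exact: W.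
  by rewrite distrC (distrC x); exact: W.
have x0 : 0 < x := lt_le_trans c0 cx.
have /andP[h1 h2] := ln_secant x0 xy.
have h3 : 0 <= (y - x) / y by rewrite divr_ge0 ?subr_ge0// ltW// (lt_le_trans x0).
rewrite distrC (distrC x) !ger0_norm ?subr_ge0//; last by rewrite -subr_ge0; lra.
rewrite (le_trans h2)// mulrC ler_wpM2r ?subr_ge0//.
by rewrite lef_pV2.
Qed.

(** By the secant bounds the remainder lies between h/(x + h) - h/x and 0. *)
Lemma ln_remainder c x h : 0 < c -> c <= x -> 0 <= h ->
  `|ln (x + h) - ln x - h / x| <= h ^+ 2 / c ^+ 2.
Proof.
move=> c0 cx h0; have x0 : 0 < x := lt_le_trans c0 cx.
have xh0 : 0 < x + h by rewrite ltr_wpDr.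
have xn : x != 0 by rewrite gt_eqF.
have xhn : x + h != 0 by rewrite gt_eqF.
have xxh : x <= x + h by rewrite lerDl.
have /andP[] := ln_secant x0 xxh.
rewrite addrAC subrr add0r => h1 h2.
have h3 : h / x - h / (x + h) <= h ^+ 2 / c ^+ 2.
  have -> : h / x - h / (x + h) = h ^+ 2 / (x * (x + h)) by field; rewrite xn xhn.
  rewrite ler_wpM2l ?sqr_ge0// lef_pV2 ?posrE ?mulr_gt0 ?exprn_gt0//.
  rewrite expr2 ler_pM ?(ltW c0)// (le_trans cx)// lerDl//.
rewrite ler_norml; apply/andP; split; first lra.
have : 0 <= h ^+ 2 / c ^+ 2 by rewrite divr_ge0 ?sqr_ge0.
lra.
Qed.

Lemma sqrt_lipschitz c x y : 0 < c -> c <= x -> c <= y ->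
  `|Num.sqrt x - Num.sqrt y| <= (Num.sqrt c)^-1 * `|x - y|.
Proof.
move=> c0 cx cy; have s0 : 0 < Num.sqrt c by rewrite sqrtr_gt0.
have x0 : 0 <= x by rewrite (le_trans (ltW c0)).
have y0 : 0 <= y by rewrite (le_trans (ltW c0)).
have sx : Num.sqrt c <= Num.sqrt x by rewrite ler_wsqrtr.
have -> : x - y = (Num.sqrt x - Num.sqrt y) * (Num.sqrt x + Num.sqrt y).
  by rewrite -subr_sqr !sqr_sqrtr.
rewrite normrM mulrCA ler_peMr// mulrC ler_pdivlMr// mul1r.
rewrite ger0_norm ?addr_ge0 ?sqrtr_ge0// (le_trans sx)// lerDl sqrtr_ge0//.
Qed.

Lemma inv_lipschitz c x y : 0 < c -> c <= x -> c <= y ->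
  `|x^-1 - y^-1| <= (c ^+ 2)^-1 * `|x - y|.
Proof.
move=> c0 cx cy; have x0 : 0 < x := lt_le_trans c0 cx.
have y0 : 0 < y := lt_le_trans c0 cy.
have -> : x^-1 - y^-1 = (x * y)^-1 * (y - x) by field; rewrite !gt_eqF.
rewrite normrM (distrC y) ler_wpM2r// ger0_norm ?invr_ge0 ?mulr_ge0 ?(ltW x0) ?(ltW y0)//.
by rewrite lef_pV2 ?posrE ?mulr_gt0 ?exprn_gt0// expr2 ler_pM// ltW.
Qed.

End ScalarEstimates.

(** * Square root and logarithm of a positive operator *)
Section OperatorFunctions.
Variables (R : realType) (H : completeNormedModType R[i]).
Variable dot : {dot H for Num.conj}.
Hypothesis Hdot : norm_from_dot dot.
Implicit Types (T S : bop H).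

Lemma coercive_opnormN T (b : R) : opnorm T <= b -> coercive dot (- b) (- T).
Proof.
move=> Tb x; rewrite bopNE rdotNl mulNr lerN2.
rewrite (le_trans (ler_norm _))// (le_trans (rdot_le Hdot _ _))//.
by rewrite expr2 mulrA ler_wpM2r ?rnorm_ge0// (le_trans (opnorm_ub _ _))//
  ler_wpM2r ?rnorm_ge0.
Qed.

Section PositiveOperator.
Variables (T : bop H) (a b : R).
Hypotheses (sT : symop dot T) (a0 : 0 < a) (ab : a < b).
Hypotheses (Ta : coercive dot a T) (Tb : coercive dot (- b) (- T)).

Let spec x : spectrum T x%:C -> a <= x <= b.
Proof. exact: (spectrum_itv Hdot sT Ta Tb). Qed.

(** The scalar identities between x^(1/2), x^(-1/2) and x hold on the
    spectrum, and the calculus is multiplicative and unique. *)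
Lemma powR_half_root : let S := bop_powR T (2^-1) in
  let S' := bop_powR T (- 2^-1) in
  [/\ symop dot S, symop dot S', S * S = T, S * S' = 1 & S' * S = 1].
Proof.
move=> S S'; have sa0 : 0 < Num.sqrt a by rewrite sqrtr_gt0.
have ge0 x : a <= x <= b -> 0 <= x by move=> /andP[ax _]; rewrite (le_trans _ ax)// ltW.
have sge x : a <= x <= b -> Num.sqrt a <= Num.sqrt x.
  by move=> /andP[ax _]; rewrite ler_wsqrtr.
have cS : is_cfc (fun x => x `^ 2^-1) T S.
  apply: (@is_cfc_exists _ _ _ Hdot a b (Num.sqrt a)^-1) => // x y xab yab.
  rewrite !powR12_sqrt ?ge0//.
  by apply: sqrt_lipschitz => //; [case/andP: xab|case/andP: yab].
have cS' : is_cfc (fun x => x `^ (- 2^-1)) T S'.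
  apply: (@is_cfc_exists _ _ _ Hdot a b ((Num.sqrt a ^+ 2)^-1 * (Num.sqrt a)^-1)) => // x y xab yab.
  rewrite !powRN !powR12_sqrt ?ge0// (le_trans (inv_lipschitz sa0 _ _)) ?sge//.
  rewrite -mulrA ler_wpM2l ?invr_ge0 ?sqr_ge0//.
  by apply: sqrt_lipschitz => //; [case/andP: xab|case/andP: yab].
pose M := Num.sqrt b + (Num.sqrt a)^-1.
have MS x : spectrum T x%:C -> `|x `^ 2^-1| <= M.
  move=> /spec xab; rewrite powR12_sqrt ?ge0// ger0_norm ?sqrtr_ge0//.
  rewrite /M (@le_trans _ _ (Num.sqrt b))//; last by rewrite lerDl invr_ge0 ltW.
  by rewrite ler_wsqrtr//; case/andP: xab.
have MS' x : spectrum T x%:C -> `|x `^ (- 2^-1)| <= M.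
  move=> /spec xab; rewrite powRN powR12_sqrt ?ge0// ger0_norm ?invr_ge0 ?sqrtr_ge0//.
  rewrite /M (@le_trans _ _ (Num.sqrt a)^-1)//; last by rewrite lerDr sqrtr_ge0.
  by rewrite lef_pV2 ?posrE// ?sge// (lt_le_trans sa0)// sge.
have one : is_cfc (fun=> 1) T 1 by have := is_cfc_cst 1 T; rewrite scale1r.
have inv1 x : spectrum T x%:C -> x `^ 2^-1 * x `^ (- 2^-1) = 1.
  move=> /spec xab; rewrite powRN mulfV// powR12_sqrt ?ge0//.
  by rewrite gt_eqF// (lt_le_trans sa0)// sge.
split.
- exact: is_cfc_symop cS.
- exact: is_cfc_symop cS'.
- apply: (is_cfc_unique Hdot sT (is_cfcM cS cS MS MS) (is_cfc_id T)).
  by move=> x /spec xab; rewrite powR12_sqrt ?ge0// -expr2 sqr_sqrtr ?ge0.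
- exact: (is_cfc_unique Hdot sT (is_cfcM cS cS' MS MS') one inv1).
apply: (is_cfc_unique Hdot sT (is_cfcM cS' cS MS' MS) one).
by move=> x /inv1; rewrite mulrC.
Qed.

(** The logarithm of T + l.  Taking it as a function of T, for every l, puts
    all these logarithms in the calculus of one operator, where they can be
    subtracted. *)
Definition log_shift (l : R) : bop H := cfc (fun x => ln (x + l)) T.

Lemma log_shiftP l : 0 <= l -> is_cfc (fun x => ln (x + l)) T (log_shift l).
Proof.
move=> l0; apply: (@is_cfc_exists _ _ _ Hdot a b a^-1) => // x y /andP[ax _] /andP[ay _].
have axl : a <= x + l by rewrite (le_trans ax)// lerDl.
have ayl : a <= y + l by rewrite (le_trans ay)// lerDl.
rewrite (le_trans (ln_lipschitz a0 axl ayl))//.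
by rewrite opprD addrACA subrr addr0.
Qed.

(** Multiplicativity makes the value at T of 1/(x + l) a left inverse of
    T + l, so it coincides with the right inverse S. *)
Lemma is_cfc_resolvent l S : 0 <= l -> (T + l%:C *: (1 : bop H)) * S = 1 ->
  is_cfc (fun x => (x + l)^-1) T S.
Proof.
move=> l0 TS.
have ge x : a <= x <= b -> a <= x + l.
  by move=> /andP[ax _]; rewrite (le_trans ax)// lerDl.
have cY : is_cfc (fun x => (x + l)^-1) T (cfc (fun x => (x + l)^-1) T).
  apply: (@is_cfc_exists _ _ _ Hdot a b (a ^+ 2)^-1) => // x y xab yab.
  rewrite (le_trans (inv_lipschitz a0 _ _)) ?ge//.
  by rewrite opprD addrACA subrr addr0.
have cT : is_cfc (fun x => x + l) T (T + l%:C *: (1 : bop H)).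
  exact: is_cfcD (is_cfc_id T) (is_cfc_cst l T).
have one : is_cfc (fun=> 1) T 1 by have := is_cfc_cst 1 T; rewrite scale1r.
pose M := a^-1 + (b + l).
have M1 x : spectrum T x%:C -> `|(x + l)^-1| <= M.
  move=> /spec xab; have xl := ge _ xab; have xl0 := lt_le_trans a0 xl.
  rewrite ger0_norm ?invr_ge0 ?(ltW xl0)//.
  rewrite (@le_trans _ _ a^-1)//; first by rewrite lef_pV2.
  by rewrite lerDl addr_ge0// ltW// (lt_trans a0).
have M2 x : spectrum T x%:C -> `|x + l| <= M.
  move=> /spec xab; have xl := ge _ xab; have xl0 := lt_le_trans a0 xl.
  rewrite ger0_norm ?(ltW xl0)// /M ler_wpDl ?invr_ge0 ?(ltW a0)//.
  by rewrite lerD2r; case/andP: xab.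
have YT : cfc (fun x => (x + l)^-1) T * (T + l%:C *: (1 : bop H)) = 1.
  apply: (is_cfc_unique Hdot sT (is_cfcM cY cT M1 M2) one).
  by move=> x /spec /ge xl; rewrite mulVf// gt_eqF// (lt_le_trans a0).
suff -> : S = cfc (fun x => (x + l)^-1) T by [].
by rewrite -[S]mul1r -YT -mulrA TS mulr1.
Qed.

Lemma log_shift_remainder l h S : 0 <= l -> 0 <= h ->
  (T + l%:C *: (1 : bop H)) * S = 1 ->
  opnorm (log_shift (l + h) - log_shift l - h%:C *: S) <= h ^+ 2 / a ^+ 2.
Proof.
move=> l0 h0 TS.
have := is_cfcB (is_cfcB (log_shiftP (addr_ge0 l0 h0)) (log_shiftP l0))
  (is_cfcZ h (is_cfc_resolvent l0 TS)).
move=> /(is_cfc_opnorm_le Hdot sT); apply; first by rewrite divr_ge0 ?sqr_ge0.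
move=> x /spec /andP[ax _]; rewrite addrA; apply: ln_remainder => //.
by rewrite (le_trans ax)// lerDl.
Qed.

(** On the spectrum ln (x + l) - ln l lies between 0 and x/l <= b/l.  The
    leading term ln l does not depend on T, and disappears from the difference
    of two logarithms. *)
Lemma log_shift_asymp l : 0 < l ->
  opnorm (log_shift l - (ln l)%:C *: (1 : bop H)) <= b / l.
Proof.
move=> l0; have := is_cfcB (log_shiftP (ltW l0)) (is_cfc_cst (ln l) T).
move=> /(is_cfc_opnorm_le Hdot sT); apply.
  by rewrite divr_ge0 ?(ltW l0)// ltW// (lt_trans a0).
move=> x /spec /andP[ax xb]; have x0 : 0 <= x by rewrite (le_trans _ ax)// ltW.
have lxl : l <= x + l by rewrite lerDr.
have /andP[h1 h2] := ln_secant l0 lxl.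
move: h1 h2; rewrite addrK => h1 h2.
have h3 : 0 <= x / (x + l) by rewrite divr_ge0// addr_ge0// ltW.
by rewrite ger0_norm ?(le_trans h3)// (le_trans h2)// ler_wpM2r// invr_ge0 ltW.
Qed.

End PositiveOperator.

End OperatorFunctions.

(** * Bochner integrals of Lipschitz operator-valued functions *)
Section BochnerOperators.
Variables (R : realType) (H : completeNormedModType R[i]).
Variable dot : {dot H for Num.conj}.
Hypothesis Hdot : norm_from_dot dot.
Notation mu := (@lebesgue_measure R).

Lemma lipschitz_measurable_fun (D : set R) (g : R -> R) (K : R) :
  measurable D -> (forall x y, D x -> D y -> `|g x - g y| <= K * `|x - y|) ->
  measurable_fun D g.
Proof.
move=> mD lip; apply: subspace_continuous_measurable_fun => //.
apply/subspace_continuousP => x Dx; apply/cvgrPdist_le => e e0.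
have K1 : 0 < `|K| + 1 by rewrite ltr_wpDl.
rewrite near_withinE; near=> y => Dy.
rewrite (le_trans (lip _ _ Dx Dy))// (@le_trans _ _ ((`|K| + 1) * `|x - y|))//.
  by rewrite ler_wpM2r// (le_trans (ler_norm K))// lerDl.
rewrite mulrC -ler_pdivlMr//; near: y.
have eK : 0 < e / (`|K| + 1) by rewrite divr_gt0.
by have /cvgrPdist_le/(_ _ eK) : id @ nbhs x --> x by [].
Unshelve. all: by end_near. Qed.

Lemma bop_eq_rdot (T S : bop H) :
  (forall x y, rdot dot (T x) y = rdot dot (S x) y) -> T = S.
Proof.
move=> TS; apply: bopP => x; apply/eqP; rewrite -subr_eq0; apply/eqP/rnorm0_eq0.
apply/eqP; rewrite -sqrf_eq0 -(rdotxx Hdot) rdotBl TS subrr.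
by [].
Qed.

(** The functionals T |-> Re <T x, y> separate operators, and their
    composites with a Lipschitz f are measurable. *)
Lemma bochner_integral_bopE (D : set R) (f : R -> bop H) (v : bop H) (K : R) :
  measurable D ->
  (forall x y, D x -> D y -> opnorm (f x - f y) <= K * `|x - y|) ->
  is_bochner_integral mu D f v -> bochner_integral mu D f = v.
Proof.
move=> mD lip fv.
have fw : is_bochner_integral mu D f (bochner_integral mu D f).
  exact: (@xgetPex _ 0 [set v | is_bochner_integral mu D f v] (ex_intro _ v fv)).
apply: bop_eq_rdot => x y.
pose C := rnorm x * rnorm y + 1.
have C0 : 0 < C by rewrite ltr_wpDl ?mulr_ge0 ?rnorm_ge0.
have phiC (T : bop H) : `|rdot dot (T x) y| <= C * rnorm T.
  rewrite (le_trans (rdot_le Hdot _ _))//.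
  rewrite (@le_trans _ _ (rnorm T * rnorm x * rnorm y))//.
    by rewrite ler_wpM2r ?rnorm_ge0// opnorm_ub.
  by rewrite -mulrA mulrC ler_wpM2r ?rnorm_ge0// /C lerDl.
have mphi : measurable_fun D ((fun T : bop H => rdot dot (T x) y) \o f).
  apply: (@lipschitz_measurable_fun _ _ (C * K)) => // s t Ds Dt /=.
  rewrite -rdotBl -[_ - _]/((f s - f t) x) (le_trans (phiC _))//.
  by rewrite -mulrA ler_wpM2l ?(ltW C0)// lip.
have phiD (S T : bop H) : rdot dot ((S + T) x) y = rdot dot (S x) y + rdot dot (T x) y.
  by rewrite bopDE rdotDl.
have phiZ (a : R) (T : bop H) : rdot dot ((a%:C *: T) x) y = a * rdot dot (T x) y.
  by rewrite bopZE rdotZl.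
exact: (@functional_bochner_unique _ _ _ _ mu D mD
  (fun T : bop H => rdot dot (T x) y) C phiD phiZ C0 phiC f _ _ mphi fw fv).
Qed.

End BochnerOperators.

(** * Tail of the integral of 1/(1 + x)^2 *)
Section InverseSquare.
Variable R : realType.
Notation mu := (@lebesgue_measure R).

Lemma inv_sqr_continuous (K : R) (x : R) : 0 <= x ->
  {for x, continuous (fun x : R => K * ((1 + x) ^+ 2)^-1)}.
Proof.
move=> x0; apply: continuousM; first exact: cvg_cst.
apply: continuousV; first by rewrite expf_neq0// gt_eqF// ltr_wpDr.
by apply: continuousM; apply: continuousD;
  [exact: cvg_cst|exact: cvg_id|exact: cvg_cst|exact: cvg_id].
Qed.

Lemma inv_sqr_tail (K a : R) : 0 <= K -> 0 <= a ->
  (\int[mu]_(x in `[a, +oo[) (K * ((1 + x) ^+ 2)^-1)%:E = (K * (1 + a)^-1)%:E)%E.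
Proof.
move=> K0 a0.
have := @ge0_continuous_FTC2y R (fun x : R => K * ((1 + x) ^+ 2)^-1)
  (fun x : R => - (K * (1 + x)^-1)) a 0.
rewrite -EFinB opprK add0r.
have dF x : a < x -> is_derive x 1 (fun x : R => - (K * (1 + x)^-1)) (K * ((1 + x) ^+ 2)^-1).
  move=> ax; have x1 : 1 + x != 0 by rewrite gt_eqF// ltr_wpDr// (le_trans a0)// ltW.
  have id1 : is_derive x 1 (fun x : R => 1 + x) (0 + 1) by apply: is_deriveD.
  have idV := is_deriveV x1 id1.
  have idZ := is_deriveZ K idV.
  have idN := is_deriveN idZ.
  apply: (is_derive_eq idN).
  by rewrite add0r scaleNr scalerN opprK /GRing.scale/= mulr1.
apply.
- by move=> x _; rewrite mulr_ge0// invr_ge0 sqr_ge0.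
- apply: continuous_in_subspaceT => x; rewrite inE/= in_itv/= andbT => ax.
  by apply: inv_sqr_continuous; exact: le_trans ax.
- apply/cvgrPdist_lt => e e0; near=> x.
  have x0 : 0 < x by near: x; exact: nbhs_pinfty_gt.
  have xK : K / e < x by near: x; exact: nbhs_pinfty_gt (num_real _).
  rewrite sub0r opprK ger0_norm ?mulr_ge0 ?invr_ge0 ?addr_ge0 ?(ltW x0)//.
  rewrite ltr_pdivrMr ?ltr_wpDl// mulrC -ltr_pdivrMr//.
  by rewrite (lt_le_trans xK)// lerDr.
- by move=> x ax; have := dF x ax; case.
- apply: cvg_at_right_filter; apply: cvgN; apply: cvgMr.
  apply: cvgV; first by rewrite gt_eqF// ltr_wpDr.
  by apply: cvgD; [exact: cvg_cst|exact: cvg_id].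
- move=> x; rewrite in_itv/= andbT => ax.
  by rewrite derive1E; have := dF x ax => ?; rewrite derive_val.
Unshelve. all: by end_near. Qed.

End InverseSquare.

(** * Integral of the resolvents of a pencil *)
Section Resolvents.
Variables (R : realType) (H : completeNormedModType R[i]).
Variable dot : {dot H for Num.conj}.
Hypothesis Hdot : norm_from_dot dot.
Notation mu := (@lebesgue_measure R).
Implicit Types T S : bop H.

Lemma resolvent_identity (Z Z' W W' : bop H) : W * Z = 1 -> Z' * W' = 1 ->
  W - W' = W * (Z' - Z) * W'.
Proof. by move=> WZ ZW'; rewrite mulrBr mulrBl -mulrA ZW' WZ mulr1 mul1r. Qed.

Lemma pos_invertible_bounds T : pos_invertible dot T ->
  symop dot T /\ exists a b,
    [/\ 0 < a, a < b, coercive dot a T & coercive dot (- b) (- T)].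
Proof.
move=> /(pos_invertible_coercive Hdot)[sT [a a0 Ta]]; split=> //.
exists a, (a + opnorm T + 1); split=> //.
  by rewrite -addrA ltrDl ltr_wpDl ?opnorm_ge0.
apply: (coercive_opnormN Hdot).
by rewrite -addrA addrCA lerDl addr_ge0// ltW.
Qed.

Variables (A B P : bop H) (c : R).
Hypotheses (sA : symop dot A) (sB : symop dot B) (sP : symop dot P).
Hypotheses (c0 : 0 < c) (cA : coercive dot c A) (cB : coercive dot c B)
  (cP : coercive dot c P).

Definition pencil (l t : R) : bop H :=
  (1 - t)%:C *: A + t%:C *: B + l%:C *: P.

Let Z := pencil.
Let W l t := bop_inv (pencil l t).

Lemma pencil0 l : pencil l 0 = A + l%:C *: P.
Proof. by rewrite /pencil subr0 !scale1r scale0r addr0. Qed.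

Lemma pencil1 l : pencil l 1 = B + l%:C *: P.
Proof. by rewrite /pencil subrr scale0r scale1r add0r. Qed.

Lemma pencil_subt l s t : pencil l s - pencil l t = (s - t)%:C *: (B - A).
Proof.
rewrite /pencil opprD addrACA subrr addr0 opprD addrACA -!scalerBl -!rmorphB.
have -> : 1 - s - (1 - t) = - (s - t) by ring.
by rewrite rmorphN scaleNr addrC -scalerBr.
Qed.

Lemma pencil_subl l l' t : pencil l t - pencil l' t = (l - l')%:C *: P.
Proof. by rewrite /pencil opprD addrACA subrr add0r -scalerBl -rmorphB. Qed.

Let cl l := c * (1 + l).

Let cl_gt0 l : 0 <= l -> 0 < cl l.
Proof. by move=> l0; rewrite mulr_gt0// ltr_wpDr. Qed.

Lemma symop_pencil l t : symop dot (pencil l t).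
Proof. by apply: symopD; [apply: symopD|]; exact: symopZ. Qed.

(** The lower bound c of A and B is kept by convex combinations, and l P adds
    c l; the growth in l is what makes the outer integral converge. *)
Lemma coercive_pencil l t : 0 <= l -> 0 <= t <= 1 -> coercive dot (cl l) (pencil l t).
Proof.
move=> l0 /andP[t0 t1] x; rewrite !bopDE !bopZE !rdotDl !rdotZl.
have := cA x; have := cB x; have := cP x; rewrite /cl; set n := rnorm x ^+ 2.
move=> hP hB hA; have t1' : 0 <= 1 - t by rewrite subr_ge0.
have := ler_wpM2l t1' hA; have := ler_wpM2l t0 hB; have := ler_wpM2l l0 hP.
lra.
Qed.

Let WZ l t : 0 <= l -> 0 <= t <= 1 -> W l t * Z l t = 1 /\ Z l t * W l t = 1.
Proof.
move=> l0 t01; apply: bop_invK.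
apply: (coercive_invertible Hdot (cl_gt0 l0)); first exact: symop_pencil.
exact: coercive_pencil.
Qed.

Let W_le l t : 0 <= l -> 0 <= t <= 1 -> opnorm (W l t) <= (cl l)^-1.
Proof.
move=> l0 t01.
exact: (opnorm_inv_le Hdot (cl_gt0 l0) (coercive_pencil l0 t01) (WZ l0 t01).2).
Qed.

Let W_lec l t : 0 <= l -> 0 <= t <= 1 -> opnorm (W l t) <= c^-1.
Proof.
move=> l0 t01; rewrite (le_trans (W_le l0 t01))// lef_pV2 ?posrE ?cl_gt0//.
by rewrite /cl ler_peMr ?(ltW c0)// lerDl.
Qed.

Let W_subt l s t : 0 <= l -> 0 <= s <= 1 -> 0 <= t <= 1 ->
  W l s - W l t = (t - s)%:C *: (W l s * (B - A) * W l t).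
Proof.
move=> l0 s01 t01; rewrite (resolvent_identity (WZ l0 s01).1 (WZ l0 t01).2).
by rewrite pencil_subt -bop_scalerAr -bop_scalerAl.
Qed.

Let W_subl l l' t : 0 <= l -> 0 <= l' -> 0 <= t <= 1 ->
  W l t - W l' t = (l' - l)%:C *: (W l t * P * W l' t).
Proof.
move=> l0 l'0 t01; rewrite (resolvent_identity (WZ l0 t01).1 (WZ l'0 t01).2).
by rewrite pencil_subl -bop_scalerAr -bop_scalerAl.
Qed.

Let k := opnorm P.
Let d := opnorm (B - A).

Let W_subt_le l s t : 0 <= l -> 0 <= s <= 1 -> 0 <= t <= 1 ->
  opnorm (W l s - W l t) <= `|s - t| * (c^-1 * d * c^-1).
Proof.
move=> l0 s01 t01; rewrite W_subt// opnormZR distrC ler_wpM2l//.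
by apply: opnormM3 => //; exact: W_lec.
Qed.

Let W_subl_le l l' t : 0 <= l -> 0 <= l' -> 0 <= t <= 1 ->
  opnorm (W l t - W l' t) <= `|l - l'| * (c^-1 * k * c^-1).
Proof.
move=> l0 s01 t01; rewrite W_subl// opnormZR distrC ler_wpM2l//.
by apply: opnormM3 => //; exact: W_lec.
Qed.

Definition entropy_integrand (l t : R) : bop H :=
  P * bop_inv (pencil l t) * (B - A) * bop_inv (pencil l t) * P.

Let PXP X e : opnorm X <= e -> opnorm (P * X * P) <= k * e * k.
Proof. by move=> Xe; exact: opnormM3. Qed.

Lemma entropy_integrandE l t :
  entropy_integrand l t = P * (W l t * (B - A) * W l t) * P.
Proof. by rewrite /entropy_integrand !mulrA. Qed.

(* The factor Z_t^-1 occurs twice in the integrand, hence the factor 2. *)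
Let Cin := 2 * (k * (c^-1 * d * (c^-1 * d * c^-1)) * k).

Let in01 (x : R) : (`[0, 1]%classic : set R) x -> 0 <= x <= 1.
Proof. by rewrite /= in_itv. Qed.

Lemma entropy_integrand_lipschitz l s t : 0 <= l ->
  `[0, 1]%classic s -> `[0, 1]%classic t ->
  opnorm (entropy_integrand l s - entropy_integrand l t) <= Cin * `|s - t|.
Proof.
move=> l0 /in01 s01 /in01 t01; rewrite !entropy_integrandE -mulrBl -mulrBr.
rewrite sandwich_sub mulrDr mulrDl (le_trans (opnormD _ _))//.
have h1 := opnormM3 (W_lec l0 s01) (lexx (opnorm (B - A))) (W_subt_le l0 s01 t01).
have h2 := opnormM3 (W_subt_le l0 s01 t01) (lexx (opnorm (B - A))) (W_lec l0 t01).
rewrite (le_trans (lerD (PXP h1) (PXP h2)))// /Cin -/d.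
by rewrite le_eqVlt; apply/orP; left; apply/eqP; ring.
Qed.

Let inner_primitive l t : bop H := - (P * W l t * P).

(** The resolvent identity makes the increment exactly
    h P Z_t^-1 (B - A) Z_(t+h)^-1 P; what remains is the increment of the last
    resolvent. *)
Lemma entropy_inner_primitive l t h : 0 <= l ->
  `[0, 1]%classic t -> `[0, 1]%classic (t + h) ->
  opnorm (inner_primitive l (t + h) - inner_primitive l t - h%:C *: entropy_integrand l t) <= Cin * h ^+ 2.
Proof.
move=> l0 /in01 t01 /in01 th01; rewrite entropy_integrandE.
have -> : inner_primitive l (t + h) - inner_primitive l t = h%:C *: (P * (W l t * (B - A) * W l (t + h)) * P).
  rewrite /inner_primitive opprK addrC -mulrBl -mulrBr (W_subt l0 t01 th01) addrAC subrr add0r.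
  by rewrite -bop_scalerAr -bop_scalerAl.
rewrite -scalerBr -mulrBl -!mulrBr opnormZR.
have hE : `|t + h - t| = `|h| by rewrite addrAC subrr add0r.
have := opnormM3 (W_lec l0 t01) (lexx (opnorm (B - A))) (W_subt_le l0 th01 t01).
rewrite hE => /PXP /(ler_wpM2l (normr_ge0 h)) /le_trans; apply.
rewrite -(real_normK (num_real h)) /Cin -/d.
pose e := k * (c^-1 * d * (c^-1 * d * c^-1)) * k; rewrite -/e; have e0 : 0 <= e.
  by rewrite /e !mulr_ge0 ?opnorm_ge0 ?invr_ge0 ?(ltW c0).
have -> : `|h| * (k * (c^-1 * d * (`|h| * (c^-1 * d * c^-1))) * k) = e * `|h| ^+ 2.
  by rewrite /e; ring.
by rewrite ler_wpM2r ?sqr_ge0// mulr_natl mulr2n lerDl.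
Qed.

Lemma entropy_inner_integral l : 0 <= l ->
  is_bochner_integral mu `[0, 1] (entropy_integrand l)
    (P * (W l 0 - W l 1) * P).
Proof.
move=> l0; pose w : R -> R := fun=> k * (c^-1 * d * c^-1) * k.
(* The range [0, 1] is fixed and cut in n + 1 steps; the tail is null. *)
apply: (@bochner_integral_derivative _ _ _ _ (inner_primitive l) w Cin
  (fun=> 1) succn) => //.
- by move=> x /in01 /andP[].
- by under eq_fun do rewrite expr1n mul1r; exact: cvg_inv_succ.
- exists [set 1]; split; [exact: measurable_set1|exact: lebesgue_measure_set1|].
  move=> x /= /not_implyP[/in01/andP[x0 x1] nx].
  apply/eqP; rewrite eq_le x1 leNgt; apply/negP => x1'; apply: nx.
  exact: nearW.
- by move=> s t s01 t01; exact: entropy_integrand_lipschitz.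
- by move=> t h t01 h0 th01; exact: entropy_inner_primitive.
- exact: measurable_cst.
- move=> t /in01 t01; rewrite /w entropy_integrandE.
  by apply: PXP; apply: opnormM3 => //; exact: W_lec.
- rewrite (_ : (fun=> _) = (fun=> 0%E)); first exact: cvg_cst.
  apply/funext => n; apply: null_set_integral => //.
  + by apply: measurableI; exact: measurable_itv.
  + by rewrite /w; exact: measurable_cst.
  apply/eqP; rewrite eq_le measure_ge0 andbT.
  rewrite -(lebesgue_measure_set1 (1 : R)) le_measure ?inE//.
    by apply: measurableI; exact: measurable_itv.
  move=> x [/in01/andP[_ x1]]; rewrite /= in_itv/= andbT => x1'.
  by apply/eqP; rewrite eq_le x1 x1'.
rewrite (_ : (fun=> _) = (fun=> P * (W l 0 - W l 1) * P)); first exact: cvg_cst.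
by apply/funext => n; rewrite /inner_primitive opprK addrC -mulrBl -mulrBr.
Qed.

Lemma entropy_innerE l : 0 <= l ->
  bochner_integral mu `[0, 1] (entropy_integrand l) = P * (W l 0 - W l 1) * P.
Proof.
move=> l0; apply: (bochner_integral_bopE Hdot _ _ (entropy_inner_integral l0)) => //.
by move=> s t s01 t01; exact: entropy_integrand_lipschitz.
Qed.

Let e01 : 0 <= (0 : R) <= 1. Proof. by rewrite lexx ler01. Qed.
Let e11 : 0 <= (1 : R) <= 1. Proof. by rewrite lexx ler01. Qed.

Let inner_value l := P * (W l 0 - W l 1) * P.

Let Kw := k * d * k * (c ^+ 2)^-1.

(** Each resolvent alone is only O(1/(1 + l)), but their difference contains a
    product of two. *)
Lemma entropy_inner_le l : 0 <= l -> opnorm (inner_value l) <= Kw * ((1 + l) ^+ 2)^-1.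
Proof.
move=> l0; rewrite /inner_value W_subt// subr0 scale1r.
have := opnormM3 (W_le l0 e01) (lexx (opnorm (B - A))) (W_le l0 e11).
move=> /PXP /le_trans; apply; rewrite -/d /Kw /cl.
have c0n : c != 0 by rewrite gt_eqF.
have l0n : 1 + l != 0 by rewrite gt_eqF// ltr_wpDr.
by rewrite le_eqVlt; apply/orP; left; apply/eqP; field; rewrite c0n l0n.
Qed.

Let Clip := 2 * (k * (c^-1 * k * c^-1) * k).

Lemma entropy_inner_lipschitz l l' : 0 <= l -> 0 <= l' ->
  opnorm (inner_value l - inner_value l') <= Clip * `|l - l'|.
Proof.
move=> l0 l'0; rewrite /inner_value -mulrBl -mulrBr.
rewrite subr_swap mulrBr mulrBl (le_trans (opnorm_sub _ _))//.
rewrite (le_trans (lerD (PXP (W_subl_le l0 l'0 e01)) (PXP (W_subl_le l0 l'0 e11))))//.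
by rewrite /Clip le_eqVlt; apply/orP; left; apply/eqP; ring.
Qed.

Variables S S' : bop H.
Hypotheses (sS' : symop dot S') (SS : S * S = P) (SS' : S * S' = 1) (S'S : S' * S = 1).

(** The coercivity constant of S' T S', from |x| <= |S| |S' x|; the added 1
    keeps the denominator positive. *)
Let a := c / (opnorm S ^+ 2 + 1).

Let a0 : 0 < a.
Proof. by rewrite divr_gt0// ltr_wpDl// sqr_ge0. Qed.

Lemma coercive_conj T : coercive dot c T -> coercive dot a (S' * T * S').
Proof.
move=> cT x; rewrite !bopME sS' (le_trans _ (cT (S' x)))//.
rewrite /a -mulrA ler_wpM2l ?(ltW c0)// mulrC ler_pdivrMr; last first.
  by rewrite ltr_wpDl// sqr_ge0.
apply: (@le_trans _ _ (opnorm S ^+ 2 * rnorm (S' x) ^+ 2)); last first.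
  by rewrite mulrC ler_wpM2l ?sqr_ge0// lerDl.
rewrite -exprMn ler_pXn2r// ?nnegrE ?mulr_ge0 ?opnorm_ge0 ?rnorm_ge0//.
by rewrite -{1}[x]bop1E -SS' bopME opnorm_ub.
Qed.

(** As P = S S, the operator S' (T + l P) S' is S' T S' + l. *)
Lemma conj_resolvent T U l : (T + l%:C *: P) * U = 1 ->
  (S' * T * S' + l%:C *: (1 : bop H)) * (S * U * S) = 1.
Proof.
move=> TU; have -> : S' * T * S' + l%:C *: (1 : bop H) = S' * (T + l%:C *: P) * S'.
  rewrite mulrDr mulrDl -bop_scalerAr -bop_scalerAl -SS.
  by rewrite mulrA S'S mul1r SS'.
by rewrite !mulrA -(mulrA _ S' S) S'S mulr1 -(mulrA S' _ U) TU mulr1 S'S.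
Qed.

Let X := S' * B * S'.
Let Y := S' * A * S'.
Let b := a + (opnorm X + opnorm Y) + 1.

Let sX : symop dot X. Proof. exact: symop_conj. Qed.
Let sY : symop dot Y. Proof. exact: symop_conj. Qed.
Let aX : coercive dot a X. Proof. exact: coercive_conj. Qed.
Let aY : coercive dot a Y. Proof. exact: coercive_conj. Qed.
Let bX : coercive dot (- b) (- X).
Proof.
apply: (coercive_opnormN Hdot); rewrite /b.
by have := opnorm_ge0 Y; have := a0; lra.
Qed.
Let bY : coercive dot (- b) (- Y).
Proof.
apply: (coercive_opnormN Hdot); rewrite /b.
by have := opnorm_ge0 X; have := a0; lra.
Qed.
Let ab : a < b.
Proof. by rewrite /b; have := opnorm_ge0 Y; have := opnorm_ge0 X; lra. Qed.

Let outer_primitive l := S * (log_shift Y l - log_shift X l) * S.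

Let C2 := opnorm S * (2 * (a ^+ 2)^-1) * opnorm S.

(** The inner integral is S ((Y + l)^-1 - (X + l)^-1) S, and each resolvent is
    the derivative of a logarithm. *)
Lemma entropy_outer_primitive l h : 0 <= l -> 0 <= h ->
  opnorm (outer_primitive (l + h) - outer_primitive l - h%:C *: inner_value l) <= C2 * h ^+ 2.
Proof.
move=> l0 h0.
have rY := log_shift_remainder Hdot sY a0 ab aY bY l0 h0
  (@conj_resolvent A (W l 0) l _).
have rX := log_shift_remainder Hdot sX a0 ab aX bX l0 h0
  (@conj_resolvent B (W l 1) l _).
have {}rY := rY ltac:(by rewrite -pencil0; exact: (WZ l0 e01).2).
have {}rX := rX ltac:(by rewrite -pencil1; exact: (WZ l0 e11).2).
have GE : inner_value l = S * (S * W l 0 * S - S * W l 1 * S) * S.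
  by rewrite /inner_value -SS -mulrBl -mulrBr !mulrA.
have -> : outer_primitive (l + h) - outer_primitive l - h%:C *: inner_value l =
   S * ((log_shift Y (l + h) - log_shift Y l - h%:C *: (S * W l 0 * S)) -
        (log_shift X (l + h) - log_shift X l - h%:C *: (S * W l 1 * S))) * S.
  have -> : h%:C *: inner_value l = S * (h%:C *: (S * W l 0 * S - S * W l 1 * S)) * S.
    by rewrite GE bop_scalerAl bop_scalerAr.
  by rewrite scalerBr /outer_primitive !mulrB_mid subr_swap2.
have := opnormM3 (lexx (opnorm S)) (le_trans (opnorm_sub _ _) (lerD rY rX)) (lexx (opnorm S)).
move=> /le_trans; apply; rewrite /C2 le_eqVlt; apply/orP; left; apply/eqP; ring.
Qed.

(** The terms ln L of the two logarithms cancel. *)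
Lemma entropy_outer_primitive_le (L : R) : 0 < L ->
  opnorm (outer_primitive L) <= opnorm S * (2 * b) * opnorm S * L^-1.
Proof.
move=> L0; rewrite /outer_primitive.
have dL : opnorm (log_shift Y L - log_shift X L) <= b / L + b / L.
  rewrite (le_trans (opnorm_triangle ((ln L)%:C *: (1 : bop H)) _ _))// lerD//.
    exact: (log_shift_asymp Hdot sY a0 ab aY bY).
  by rewrite opnormBC; exact: (log_shift_asymp Hdot sX a0 ab aX bX).
have := opnormM3 (lexx (opnorm S)) dL (lexx (opnorm S)).
by move=> /le_trans; apply; rewrite le_eqVlt; apply/orP; left; apply/eqP; ring.
Qed.

Let dominant x := Kw * ((1 + x) ^+ 2)^-1.

(** The primitive vanishes at infinity, so the integral is the opposite of its
    value at 0. *)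
Lemma entropy_outer_integral :
  is_bochner_integral mu `[0, +oo[ inner_value (S * (log_shift X 0 - log_shift Y 0) * S).
Proof.
have ge0P (x : R) : (`[0, +oo[%classic : set R) x -> 0 <= x.
  by rewrite /= in_itv/= andbT.
have kd0 : 0 <= Kw.
  by rewrite /Kw !mulr_ge0 ?opnorm_ge0// invr_ge0 sqr_ge0.
have Cl0 : 0 <= Clip.
  by rewrite /Clip !mulr_ge0 ?opnorm_ge0 ?invr_ge0 ?(ltW c0).
have C20 : 0 <= C2.
  by rewrite /C2 !mulr_ge0 ?opnorm_ge0 ?invr_ge0 ?sqr_ge0.
(* The range [0, n + 1] is cut in (n + 1)^3 steps, so that the error, of order
   L^2 / N, is 1 / (n + 1). *)
apply: (@bochner_integral_derivative _ _ _ _ outer_primitive dominant (Clip + C2)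
  (fun n => n.+1%:R) (fun n => n.+1 ^ 3)%N).
- exact: measurable_itv.
- exact: ge0P.
- by move=> n; rewrite ler1n.
- by move=> n x /andP[x0 _]; rewrite /= in_itv/= andbT.
- by move=> n; rewrite expn_gt0.
- have -> : (fun n => (Clip + C2) * (n.+1%:R ^+ 2 / (n.+1 ^ 3)%:R)) =
      (fun n => (Clip + C2) * n.+1%:R^-1).
    apply/funext => n; rewrite natrX; congr (_ * _).
    by have n0 : n.+1%:R != 0 :> R by []; field.
  exact: cvg_inv_succ.
- have aeF : Filter (almost_everywhere mu) by exact: ae_filter_ringOfSetsType.
  apply: nearW => x _; exists (Num.truncn x) => // n /= xn.
  by rewrite (lt_le_trans (truncnS_gt x))// ler_nat.
- move=> l l' /ge0P l0 /ge0P l'0; rewrite (le_trans (entropy_inner_lipschitz l0 l'0))//.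
  by rewrite ler_wpM2r// lerDl.
- move=> l h /ge0P l0 h0 _; rewrite (le_trans (entropy_outer_primitive l0 h0))//.
  by rewrite ler_wpM2r ?sqr_ge0// lerDr.
- apply: subspace_continuous_measurable_fun; first exact: measurable_itv.
  apply: continuous_in_subspaceT => x; rewrite inE => /ge0P x0.
  exact: inv_sqr_continuous.
- by move=> l /ge0P; exact: entropy_inner_le.
- rewrite (_ : (fun=> _) = (fun n => (Kw * (1 + n.+1%:R)^-1)%:E)); last first.
    apply/funext => n; rewrite setIidr; first exact: inv_sqr_tail.
    by move=> x; rewrite /= !in_itv/= !andbT; exact: le_trans.
  apply: cvg_EFin; first exact: nearW.
  apply: (@squeeze_cvgr _ _ _ _ (fun=> 0) (fun n => Kw * n.+1%:R^-1)).
  + apply: nearW => n; rewrite mulr_ge0 ?invr_ge0//= ler_wpM2l//.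
    by rewrite lef_pV2 ?posrE ?ltr_wpDr// lerDr.
  + exact: cvg_cst.
  exact: cvg_inv_succ.
apply: (@cvg_rnorm_le _ _ _ _ (fun n => opnorm S * (2 * b) * opnorm S * n.+1%:R^-1)); last first.
  exact: cvg_inv_succ.
move=> n; have -> : S * (log_shift X 0 - log_shift Y 0) * S = - outer_primitive 0.
  by rewrite /outer_primitive -mulNr -mulrN opprB.
rewrite opprK subrK.
exact: entropy_outer_primitive_le.
Qed.

End Resolvents.

(** * Integral representation of the relative operator entropy *)
Lemma log_shift0 (R : realType) (H : normedModType R[i]) (T : bop H) :
  cfc (@ln R) T = cfc (fun x => ln (x + 0)) T.
Proof. by congr (cfc _ T); apply/funext => x; rewrite addr0. Qed.

Theorem theorem6 (R : realType) (H : completeNormedModType R[i])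
    (dot : {dot H for Num.conj}) (Hdot : norm_from_dot dot)
    (A B P : bop H)
    (A_gt0 : pos_invertible dot A) (B_gt0 : pos_invertible dot B)
    (P_gt0 : pos_invertible dot P) :
  let integrand (l t : R) : bop H :=
    let Z := (1 - t)%:C *: A + t%:C *: B + l%:C *: P in
    P * bop_inv Z * (B - A) * bop_inv Z * P in
  let inner (l : R) : bop H :=
    bochner_integral (@lebesgue_measure R) `[0, 1] (integrand l) in
  [/\ forall l : R, 0 <= l ->
        bochner_integrable (@lebesgue_measure R) `[0, 1] (integrand l),
      bochner_integrable (@lebesgue_measure R) `[0, +oo[ inner &
      rel_op_entropy P B - rel_op_entropy P A =
        bochner_integral (@lebesgue_measure R) `[0, +oo[ inner].
Proof.
move=> integrand inner.
have [sA [cA cA0 coA]] := pos_invertible_coercive Hdot A_gt0.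
have [sB [cB cB0 coB]] := pos_invertible_coercive Hdot B_gt0.
have [sP [aP [bP [aP0 abP coP coP']]]] := pos_invertible_bounds Hdot P_gt0.
have [sS sS' SS SS' S'S] := powR_half_root Hdot sP aP0 abP coP coP'.
pose c := Num.min cA (Num.min cB aP).
have c0 : 0 < c by rewrite !lt_min cA0 cB0.
have {}coA : coercive dot c A by apply: coercive_le coA; rewrite ge_min lexx.
have {}coB : coercive dot c B.
  by apply: coercive_le coB; rewrite !ge_min lexx orbT.
have {}coP : coercive dot c P.
  by apply: coercive_le coP; rewrite !ge_min lexx !orbT.
pose G l := P * (bop_inv (pencil A B P l 0) - bop_inv (pencil A B P l 1)) * P.
have ge0 (l : R) : (`[0, +oo[%classic : set R) l -> 0 <= l.
  by rewrite /= in_itv/= andbT.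
have innerE l : 0 <= l -> inner l = G l.
  exact: (entropy_innerE Hdot sA sB sP c0 coA coB coP).
have outer := entropy_outer_integral Hdot sA sB sP c0 coA coB coP sS' SS SS' S'S.
have {}outer : is_bochner_integral (@lebesgue_measure R) `[0, +oo[ inner
    (rel_op_entropy P B - rel_op_entropy P A).
  rewrite /rel_op_entropy/= !log_shift0 mulrB_mid.
  by apply: is_bochner_integral_ext outer => l /ge0 /innerE.
split.
- move=> l l0; eexists.
  exact: (entropy_inner_integral Hdot sA sB sP c0 coA coB coP l0).
- by eexists; exact: outer.
symmetry; apply: (bochner_integral_bopE Hdot _ _ outer); first exact: measurable_itv.
move=> l l' /ge0 l0 /ge0 l'0; rewrite !innerE//.
exact: (entropy_inner_lipschitz Hdot sA sB sP c0 coA coB coP l0 l'0).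
Qed.
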